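(* Consider the directed preferential attachment model with parameters $\alpha,\beta,\gamma,\lambda,\mu$, let $p(i,j)$ be its (asymptotic) joint mass function of in- and out-degrees, and let $$c_1=\frac{\alpha+\beta}{1+\lambda(\alpha+\gamma)},\qquad c_2=\frac{\beta+\gamma}{1+\mu(\alpha+\gamma)},\qquad a=\frac{c_2}{c_1} .$$ Suppose $c_1\ne c_2$. Then $p(i,j)$ is embeddable and nonstandard regularly varying with scaling functions $b_i(t)=t^{c_i}$, $i=1,2$, and for all $x,y>0$ it satisfies $$\lim_{n\to\infty}\frac{p([n^{c_1}x],[n^{c_2}y])}{n^{-(1+c_1+c_2)}}=\frac{\gamma}{\alpha+\gamma}\,\frac{x^{\lambda}y^{\mu-1}}{c_1\Gamma(\lambda+1)\Gamma(\mu)}\int_0^\infty z^{-(2+1/c_1+\lambda+a\mu)}e^{-\left(\frac{x}{z}+\frac{y}{z^a}\right)}\,dz+\frac{\alpha}{\alpha+\gamma}\,\frac{x^{\lambda-1}y^{\mu}}{c_1\Gamma(\lambda)\Gamma(\mu+1)}\int_0^\infty z^{-(1+a+1/c_1+\lambda+a\mu)}e^{-\left(\frac{x}{z}+\frac{y}{z^a}\right)}\,dz .$$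
   Context: Model. The parameters $\alpha,\beta,\gamma,\lambda,\mu$ are strictly positive with $\alpha+\beta+\gamma=1$ and $\alpha,\beta,\gamma<1$. Start from a finite directed graph $G(n_0)$ with at least one node and $n_0$ edges. For $n\ge n_0$, $G(n)$ has $n$ edges and a random number $N(n)$ of nodes; $D_{in}(v),D_{out}(v)$ denote the in- and out-degree of $v$ in $G(n)$. $G(n+1)$ is obtained from $G(n)$ as follows. (i) With probability $\alpha$, a new node $w$ is born with an edge from $w$ to an existing node $v$, chosen with probability $(D_{in}(v)+\lambda)/(n+\lambda N(n))$. (ii) With probability $\beta$, an edge from $v$ to $w$ is added between existing nodes, where $v$ and $w$ are chosen independently, $v$ with probability $(D_{out}(v)+\mu)/(n+\mu N(n))$ and $w$ with probability $(D_{in}(w)+\lambda)/(n+\lambda N(n))$. (iii) With probability $\gamma$, a new node $w$ is born with an edge from an existing node $v$ to $w$, where $v$ is chosen with probability $(D_{out}(v)+\mu)/(n+\mu N(n))$. Let $N_{ij}(n)$ be the number of nodes of $G(n)$ with in-degree $i$ and out-degree $j$. It is known that there are non-random constants $p(i,j)$ with $N_{ij}(n)/N(n)\to p(i,j)$ almost surely, $i,j=0,1,2,\dots$. It is also known that $p(i,j)=\mathbf{P}[I=i,O=j]$, where $$(I,O)\stackrel{d}{=}B(1+X_1,Y_1)+(1-B)(X_2,1+Y_2),$$ $B$ is Bernoulli, independent of $(X_j,Y_j)$, $j=1,2$, with $\mathbf{P}(B=1)=\gamma/(\alpha+\gamma)$, and $$(X_1,Y_1)=(T_{\lambda+1}(Z^{-1}),\tilde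 T_{\mu}(Z^{-a})),\qquad (X_2,Y_2)=(T_{\lambda}(Z^{-1}),\tilde T_{\mu+1}(Z^{-a})).$$ Here $Z$ is Pareto on $[1,\infty)$ with $\mathbf{P}(Z>z)=z^{-1/c_1}$, $z\ge1$; $\{T_\delta(q)\}$ and $\{\tilde T_\delta(q)\}$, $q\in(0,1)$, are independent families of negative binomial variables, independent of $Z$, with $\mathbf{P}(T_\delta(q)=i)=\frac{\Gamma(i+\delta)}{\Gamma(\delta)\Gamma(i+1)}q^\delta(1-q)^i$, $i=0,1,2,\dots$. Terminology. $[x]$ is the largest integer $\le x$. For $\rho\in\mathbb{R}$, $h\in RV_\rho$ means that $h:(0,\infty)\to(0,\infty)$ is measurable and $\lim_{t\to\infty}h(tx)/h(t)=x^\rho$ for all $x>0$. $p$ is (nonstandard) regularly varying with scaling functions $b_1,b_2$ if for some $\rho\in\mathbb{R}$ and $h\in RV_\rho$ the limit $\lim_{n\to\infty}p([b_1(n)x],[b_2(n)y])/h(n)$ exists and is positive for all $x,y>0$. $p$ is embeddable if $g(x,y):=p([x],[y])$ is regularly varying as a function of continuous variables, i.e. $\lim_{t\to\infty}g(b_1(t)x,b_2(t)y)/h(t)$ ($t$ real) exists and is positive for all $x,y>0$, for some such $h$. *)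

(* Defs.v *)
From HB Require Import structures.
From mathcomp Require Import all_boot all_order all_algebra.
From mathcomp Require Import all_classical all_reals all_analysis.
Import Order.TTheory GRing.Theory Num.Theory numFieldNormedType.Exports.

Set Implicit Arguments.
Unset Strict Implicit.
Unset Printing Implicit Defensive.

Local Open Scope classical_set_scope.
Local Open Scope ring_scope.

Definition Gamma (R : realType) (s : R) : R :=
  Rintegral (@lebesgue_measure R) `]0, +oo[
    (fun t : R => t `^ (s - 1) * expR (- t)).

(** Directed multigraphs (loops and parallel edges allowed).  [(N, s)] has node
    set [{0, ..., N - 1}], in order of birth, and list of edges [s], most recent
    first, where [(v, w)] is an edge from [v] to [w]. *)
Notation digraph := (nat * seq (nat * nat))%type.

Definition nb_nodes (g : digraph) : nat := g.1.
Definition nb_edges (g : digraph) : nat := size g.2.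
Definition in_degree (g : digraph) (v : nat) : nat :=
  count (fun e : nat * nat => e.2 == v) g.2.
Definition out_degree (g : digraph) (v : nat) : nat :=
  count (fun e : nat * nat => e.1 == v) g.2.
Definition wf_digraph (g : digraph) : bool :=
  all (fun e : nat * nat => (e.1 < nb_nodes g) && (e.2 < nb_nodes g))%N g.2.

Definition nb_nodes_of_degree (g : digraph) (i j : nat) : nat :=
  #|[set v : 'I_(nb_nodes g) | (in_degree g v == i) && (out_degree g v == j)]%SET|.

Definition add_edge (g : digraph) (v w : nat) : digraph :=
  (nb_nodes g, (v, w) :: g.2).
Definition add_node_from (g : digraph) (v : nat) : digraph :=
  ((nb_nodes g).+1, (nb_nodes g, v) :: g.2).
Definition add_node_to (g : digraph) (v : nat) : digraph :=
  ((nb_nodes g).+1, (v, nb_nodes g) :: g.2).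

Section Model.
Context {R : realType}.

Definition in_weight (lambda : R) (g : digraph) (v : nat) : R :=
  ((in_degree g v)%:R + lambda) / ((nb_edges g)%:R + lambda * (nb_nodes g)%:R).
Definition out_weight (mu : R) (g : digraph) (v : nat) : R :=
  ((out_degree g v)%:R + mu) / ((nb_edges g)%:R + mu * (nb_nodes g)%:R).

Definition transition (alpha beta gamma lambda mu : R) (g g' : digraph) : R :=
  alpha * (\sum_(v < nb_nodes g | g' == add_node_from g v) in_weight lambda g v)
  + beta * (\sum_(v < nb_nodes g) \sum_(w < nb_nodes g | g' == add_edge g v w)
              out_weight mu g v * in_weight lambda g w)
  + gamma * (\sum_(v < nb_nodes g | g' == add_node_to g v) out_weight mu g v).

(** [G n] is relevant for [n0 <= n] only.  The evolution law says that, given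
    the whole past [G(n0), ..., G(n)], the law of [G(n+1)] is
    [transition (G(n))]. *)
Record preferential_attachment (alpha beta gamma lambda mu : R)
    (n0 : nat) (g0 : digraph) (d : measure_display) (Omega : measurableType d)
    (P : probability Omega R) (G : nat -> Omega -> digraph) : Prop := {
  pa_init_wf : wf_digraph g0;
  pa_init_nodes : (0 < nb_nodes g0)%N;
  pa_init_edges : nb_edges g0 = n0;
  pa_measurable : forall (n : nat) (g : digraph), (n0 <= n)%N ->
    measurable [set om | G n om = g];
  pa_start : P [set om | G n0 om = g0] = 1%E;
  pa_step : forall (n : nat) (past : nat -> digraph) (g : digraph),
    (n0 <= n)%N ->
    P ([set om | forall k, (n0 <= k <= n)%N -> G k om = past k]
       `&` [set om | G n.+1 om = g])
    = (P [set om | forall k, (n0 <= k <= n)%N -> G k om = past k]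
       * (transition alpha beta gamma lambda mu (past n) g)%:E)%E
}.

Definition asymptotic_joint_pmf (d : measure_display) (Omega : measurableType d)
    (P : probability Omega R) (G : nat -> Omega -> digraph)
    (p : nat -> nat -> R) : Prop :=
  forall i j : nat, {ae P, forall om,
    ((nb_nodes_of_degree (G n om) i j)%:R / (nb_nodes (G n om))%:R : R)
      @[n --> \oo] --> p i j}.

Definition neg_binomial_pmf (delta q : R) (i : nat) : R :=
  Gamma (i%:R + delta) / (Gamma delta * Gamma (i%:R + 1))
  * q `^ delta * (1 - q) ^+ i.

(** The family [{T_delta(q)}] is written [T delta q (U om)], with [U] a random
    element carrying its randomness and [T delta] jointly measurable: this is
    what makes evaluation at the random parameter [q = Z^-1] meaningful, and
    independence of the family from [Z] is independence of [U] from [Z].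
    Similarly for the second family, [T' delta q (U' om)]. *)
Record mixing_variables (c1 : R)
    (d : measure_display) (Omega : measurableType d) (P : probability Omega R)
    (d1 : measure_display) (E : measurableType d1)
    (d2 : measure_display) (E' : measurableType d2)
    (Z : Omega -> R) (U : Omega -> E) (U' : Omega -> E')
    (T : R -> R -> E -> nat) (T' : R -> R -> E' -> nat) : Prop := {
  mix_Z_measurable : measurable_fun setT Z;
  mix_U_measurable : measurable_fun setT U;
  mix_U'_measurable : measurable_fun setT U';
  mix_T_measurable : forall delta : R, 0 < delta ->
    measurable_fun setT (fun qe : R * E => T delta qe.1 qe.2);
  mix_T'_measurable : forall delta : R, 0 < delta ->
    measurable_fun setT (fun qe : R * E' => T' delta qe.1 qe.2);
  mix_indep : forall (A : set R) (C : set E) (C' : set E'),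
    measurable A -> measurable C -> measurable C' ->
    P (Z @^-1` A `&` U @^-1` C `&` U' @^-1` C')
    = (P (Z @^-1` A) * P (U @^-1` C) * P (U' @^-1` C'))%E;
  mix_Z_pareto : forall z : R, 1 <= z ->
    P [set om | z < Z om] = (z `^ (- c1^-1))%:E;
  mix_T_law : forall (delta q : R) (i : nat), 0 < delta -> 0 < q < 1 ->
    P [set om | T delta q (U om) = i] = (neg_binomial_pmf delta q i)%:E;
  mix_T'_law : forall (delta q : R) (i : nat), 0 < delta -> 0 < q < 1 ->
    P [set om | T' delta q (U' om) = i] = (neg_binomial_pmf delta q i)%:E
}.

Definition independent_bernoulli (r : R)
    (d : measure_display) (Omega : measurableType d) (P : probability Omega R)
    (B : Omega -> bool) (X Y : Omega -> nat) : Prop :=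
  [/\ measurable_fun setT B,
      P [set om | B om = true] = r%:E &
      forall (b : bool) (i j : nat),
        P [set om | B om = b /\ (X om = i /\ Y om = j)]
        = (P [set om | B om = b] * P [set om | X om = i /\ Y om = j])%E].

(** [p(i,j) = P[I = i, O = j]] where
    [(I, O) = B (1 + X1, Y1) + (1 - B) (X2, 1 + Y2)]. *)
Definition mixture_representation (alpha gamma lambda mu c1 a : R)
    (p : nat -> nat -> R)
    (d : measure_display) (Omega : measurableType d) (P : probability Omega R)
    (d1 : measure_display) (E : measurableType d1)
    (d2 : measure_display) (E' : measurableType d2)
    (B : Omega -> bool) (Z : Omega -> R) (U : Omega -> E) (U' : Omega -> E')
    (T : R -> R -> E -> nat) (T' : R -> R -> E' -> nat) : Prop :=
  let X1 om := T (lambda + 1) (Z om)^-1 (U om) in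
  let Y1 om := T' mu (Z om `^ (- a)) (U' om) in
  let X2 om := T lambda (Z om)^-1 (U om) in
  let Y2 om := T' (mu + 1) (Z om `^ (- a)) (U' om) in
  let I om := (B om * (1 + X1 om) + ~~ B om * X2 om)%N in
  let O om := (B om * Y1 om + ~~ B om * (1 + Y2 om))%N in
  [/\ mixing_variables c1 P Z U U' T T',
      independent_bernoulli (gamma / (alpha + gamma)) P B X1 Y1,
      independent_bernoulli (gamma / (alpha + gamma)) P B X2 Y2 &
      forall i j : nat, (p i j)%:E = P [set om | I om = i /\ O om = j]].

Definition RV (rho : R) (h : R -> R) : Prop :=
  [/\ forall t, 0 < t -> 0 < h t,
      measurable_fun (`]0, +oo[ : set R) h &
      forall x, 0 < x -> h (t * x) / h t @[t --> +oo] --> x `^ rho].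

(** On positive reals [Num.truncn] is the integer part, as a natural number. *)
Definition nonstandard_regularly_varying (b1 b2 : R -> R)
    (p : nat -> nat -> R) : Prop :=
  exists (rho : R) (h : R -> R), RV rho h /\
    forall x y : R, 0 < x -> 0 < y -> exists2 l : R, 0 < l &
      p (Num.truncn (b1 n%:R * x)) (Num.truncn (b2 n%:R * y)) / h n%:R
        @[n --> \oo] --> l.

Definition embeddable (b1 b2 : R -> R) (p : nat -> nat -> R) : Prop :=
  let g x y := p (Num.truncn x) (Num.truncn y) in
  exists (rho : R) (h : R -> R), RV rho h /\
    forall x y : R, 0 < x -> 0 < y -> exists2 l : R, 0 < l &
      g (b1 t * x) (b2 t * y) / h t @[t --> +oo] --> l.

End Model.

(* Main.v *)
(** Conditioning on [Z], the negative binomial pair has joint mass function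
    [E[nb_delta(1/Z)(k) * nb_delta'(Z^-a)(l)]].  Writing this expectation with the
    density of [Z / s], [s = t^c1], puts it in the form
    [Gamma-ratios * s^(-(1/c1 + delta + a delta')) * integral over (1/s, oo) of
    w^-sigma (1 - 1/(s w))^k (1 - (s w)^-a)^l dw].  When [k ~ s x] and [l ~ s^a y] the
    Gamma ratios are equivalent to powers of [k] and [l], and the integral converges to
    that of [w^-sigma exp (-(x / w + y / w^a))] by dominated convergence, since
    [(1 - 1/(s w))^k <= exp (-x / (2 w))] for large [s].  Splitting on [B], the two
    components of the mixture have the same order [t^-(1 + c1 + c2)]. *)

Require Import Defs.
From HB Require Import structures.
From mathcomp Require Import all_boot all_order all_algebra.
From mathcomp Require Import all_classical all_reals all_analysis measurable_realfun.
From mathcomp Require Import ring lra zify.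
Import Order.TTheory GRing.Theory Num.Theory numFieldNormedType.Exports.

Local Open Scope classical_set_scope.
Local Open Scope ring_scope.
Set Implicit Arguments.
Unset Strict Implicit.
Unset Printing Implicit Defensive.

(** * Powers and exponentials *)

(** The two mixture components have the same order because [delta] and [delta'] cancel. The density
    and the factors [q^delta] give [s^-(1/c1 + delta + a delta')], and the Gamma ratios give
    [s^(delta - 1)] and [s^(a (delta' - 1))]. What remains is [s^-(1/c1 + 1 + a)], which is
    [t^-(1 + c1 + c2)]. Conditioning on [Z] is an application of Fubini: the law of [(Z, U, U')] is
    a product, and for fixed [z] the event is a rectangle in [(U, U')]. The Gamma ratios are needed
    for real [delta]; concavity of powers bounds Gamma over steps of length at most 1, and the
    recursion does the rest. Limits are proved along an arbitrary sequence tending to infinity, so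
    that one statement yields both the limit over integers and, by the sequential criterion, the
    limit in real [t] that embeddability asks for. *)

Section RealAnalysis.
Context {R : realType}.
Implicit Types (x p s c : R).

Lemma powR_continuous p x : 0 < x -> {for x, continuous (fun y : R => y `^ p)}.
Proof.
move=> x0; apply/differentiable_continuous/derivable1_diffP.
by apply: derivable_powR; rewrite in_itv/= x0.
Qed.

Lemma cvg_near_eq {T : Type} {F : set_system T} {FF : Filter F} (f g : T -> R) (l : R) :
  (\forall t \near F, f t = g t) -> f t @[t --> F] --> l -> g t @[t --> F] --> l.
Proof.
move=> fg; apply: cvg_trans; apply: near_eq_cvg.
by apply: filterS fg => t ->.
Qed.

Lemma cvg_powR {T : Type} {F : set_system T} {FF : Filter F} (f : T -> R) (l p : R) :
  0 < l -> f t @[t --> F] --> l -> f t `^ p @[t --> F] --> l `^ p.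
Proof.
move=> l0 fl.
apply: (@cvg_comp _ _ _ f (fun y => y `^ p) F (nbhs l) (nbhs (l `^ p))) => //.
exact: powR_continuous.
Qed.

Lemma cvg_expR {T : Type} {F : set_system T} {FF : Filter F} (f : T -> R) (l : R) :
  f t @[t --> F] --> l -> expR (f t) @[t --> F] --> expR l.
Proof.
move=> fl.
apply: (@cvg_comp _ _ _ f expR F (nbhs l) (nbhs (expR l))) => //.
exact: continuous_expR.
Qed.

Lemma cvgy_powR {T : Type} {F : set_system T} {FF : Filter F} (f : T -> R) p :
  0 < p -> f t @[t --> F] --> +oo -> f t `^ p @[t --> F] --> +oo.
Proof.
move=> p0 fy; apply/cvgryPge => A; near=> t.
have f1 : 1 <= f t by near: t; apply: (cvgryPge f).1 fy _.
(* [Num.max A 1] is nonnegative whatever [A] is, so that its power [p^-1] raised to [p] gives it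
   back. *)
have fA : (Num.max A 1) `^ p^-1 <= f t by near: t; apply: (cvgryPge f).1 fy _.
rewrite (le_trans (_ : A <= Num.max A 1))// ?le_max ?lexx//.
rewrite -[leLHS]powRr1 ?le_max ?ler01 ?orbT// -[X in _ `^ X](mulVf (lt0r_neq0 p0)).
rewrite powRrM ge0_ler_powR ?nnegrE ?powR_ge0//; first exact: ltW.
by rewrite (le_trans _ f1).
Unshelve. all: by end_near. Qed.

Lemma cvgVy_powR {T : Type} {F : set_system T} {FF : Filter F} (f : T -> R) p :
  0 < p -> f t @[t --> F] --> +oo -> f t `^ (- p) @[t --> F] --> 0.
Proof.
move=> p0 fy.
under eq_fun do rewrite powRN.
apply/gtr0_cvgV0; last exact: cvgy_powR.
by near=> t; rewrite powR_gt0//; near: t; apply: (cvgryPgt f).1 fy _.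
Unshelve. all: by end_near. Qed.

(* [1 / (1 - q) = 1 + q / (1 - q) <= exp (q / (1 - q))] gives the lower bound. *)
Lemma onem_expn_ge (q : R) n : 0 <= q < 1 -> expR (- (n%:R * q / (1 - q))) <= (1 - q) ^+ n.
Proof.
move=> /andP[q0 q1]; have q1' : 0 < 1 - q by rewrite subr_gt0.
rewrite -mulrA expRN mulrC expRM_natr -exprVn lerXn2r ?nnegrE ?invr_ge0 ?expR_ge0 ?(ltW q1')//.
rewrite -[leRHS]invrK lef_pV2 ?posrE ?expR_gt0 ?invr_gt0//.
apply: le_trans (expR_ge1Dx _).
rewrite le_eqVlt; apply/orP; left; apply/eqP; field; lra.
Qed.

Lemma onem_expn_le (q : R) n : q <= 1 -> (1 - q) ^+ n <= expR (- (n%:R * q)).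
Proof.
move=> q1; rewrite -mulrN mulrC expRM_natr.
by rewrite lerXn2r ?nnegrE ?expR_ge0 ?subr_ge0// (le_trans _ (expR_ge1Dx _)).
Qed.

(** Squeeze between [exp (- k q / (1 - q))] and [exp (- k q)]: both exponents tend to [- c] because
    [q] tends to 0. *)
Lemma cvg_onem_expn (k : nat -> nat) (q : nat -> R) c :
  (\forall n \near \oo, 0 <= q n) ->
  q n @[n --> \oo] --> 0 -> (k n)%:R * q n @[n --> \oo] --> c ->
  (1 - q n) ^+ k n @[n --> \oo] --> expR (- c).
Proof.
move=> q0 ql kql.
have ql1 : 1 - q n @[n --> \oo] --> (1 : R).
  by rewrite -[X in _ --> X]subr0; apply: cvgB => //; exact: cvg_cst.
have H1 : expR (- ((k n)%:R * q n / (1 - q n))) @[n --> \oo] --> expR (- c).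
  apply: cvg_expR.
  apply: cvgN; rewrite -[X in _ --> X]divr1; apply: cvgM => //.
  by apply: cvgV => //; rewrite oner_neq0.
have H2 : expR (- ((k n)%:R * q n)) @[n --> \oo] --> expR (- c).
  apply: cvg_expR.
  exact: cvgN.
apply: squeeze_cvgr H1 H2; near=> n.
have qn0 : 0 <= q n by near: n.
have qn1 : q n < 1 by near: n; apply: (cvgr_lt _ ql); rewrite ltr01.
by rewrite onem_expn_ge ?qn0// onem_expn_le// ltW.
Unshelve. all: by end_near. Qed.

Lemma powR_expR_bounded s c : 0 <= s -> 0 < c ->
  exists C : R, forall u, 0 < u -> u `^ s * expR (- (c * u)) <= C.
Proof.
move=> s0 c0; pose n := (Num.truncn s).+1.
have sn : s <= n%:R by apply/ltW/truncnS_gt.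
(* The summand 1 covers [u <= 1]. For [u > 1], [u^s <= u^n], and the term [(c u)^n / n!] of the
   exponential series gives the other summand. *)
exists (1 + n`!%:R / c ^+ n) => u u0.
have D0 : 0 <= n`!%:R / c ^+ n by rewrite divr_ge0 ?exprn_ge0 ?ltW.
have e1 : expR (- (c * u)) <= 1 by rewrite expR_le1 oppr_le0 mulr_ge0 ?ltW.
have [u1|u1] := leP u 1.
  rewrite -[leLHS]addr0 lerD// mulr_ile1 ?powR_ge0 ?expR_ge0//.
  have -> : 1 = 1 `^ s :> R by rewrite powR1.
  by apply: ge0_ler_powR; rewrite ?nnegrE ?ler01// ltW.
rewrite -[leLHS]add0r lerD//.
have un : u `^ s <= u ^+ n by rewrite -powR_mulrn ?ler_powR ?(ltW u0) ?(ltW u1).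
apply: le_trans (ler_wpM2r (expR_ge0 _) un) _.
have fn0 : 0 < n`!%:R :> R by rewrite ltr0n fact_gt0.
have cun : (c * u) ^+ n / n`!%:R <= expR (c * u).
  apply: le_trans (expR_ge1Dxn (Num.truncn s) _); first by rewrite lerDr.
  by rewrite mulr_ge0// ltW.
rewrite expRN ler_pdivrMr ?expR_gt0//.
apply: le_trans (ler_wpM2l D0 cun).
rewrite exprMn le_eqVlt; apply/orP; left; apply/eqP; field.
by rewrite !gt_eqF// exprn_gt0.
Qed.

Lemma cvg_powR_expR {T : Type} {F : set_system T} {FF : Filter F} (f : T -> R) s :
  0 <= s -> f t @[t --> F] --> +oo -> f t `^ s * expR (- f t) @[t --> F] --> 0.
Proof.
move=> s0 fy.
(* One spare power: boundedness for the exponent [s + 1] is decay like [C / f t] for the exponent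
   [s]. *)
have [C HC] := @powR_expR_bounded (s + 1) 1 (addr_ge0 s0 ler01) ltr01.
have H : C * (f t)`^ (- 1) @[t --> F] --> 0.
  by rewrite -(mulr0 C); apply: cvgMr; apply: cvgVy_powR.
apply: squeeze_cvgr (cvg_cst 0) H; near=> t.
have ft0 : 0 < f t by near: t; apply: (cvgryPgt f).1 fy _.
rewrite mulr_ge0 ?powR_ge0 ?expR_ge0//= powR_inv1 ?(ltW ft0)// ler_pdivlMr//.
have := HC _ ft0; rewrite mul1r powRD ?powRr1 ?(ltW ft0)//; last by rewrite (gt_eqF ft0) implybT.
by rewrite mulrAC.
Unshelve. all: by end_near. Qed.

(** For [Z > 1] both negative binomial parameters lie strictly inside the unit interval, the range
    in which their laws are prescribed. *)
Lemma inv_powRN_itv01 (a z : R) : 0 < a -> 1 < z ->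
  0 < z^-1 < 1 /\ 0 < z `^ (- a) < 1.
Proof.
move=> a0 z1; have z0 := lt_trans ltr01 z1; rewrite invr_gt0 z0 invf_lt1// z1; split => //.
rewrite powR_gt0//= powRN invf_lt1 ?powR_gt0//.
have E1 : 1 `^ a = 1 :> R by rewrite powR1.
by rewrite -[X in X < _]E1 gt0_ltr_powR// nnegrE ltW.
Qed.

End RealAnalysis.

(** * The Gamma function *)

Section GammaFunction.
Context {R : realType}.
Local Notation mu := (@lebesgue_measure R).
(** Compact exhaustion of the half-line, away from the possible singularity at 0. The shift by 2
    makes the endpoints distinct already for [n = 0], as integration by parts requires. *)
Local Notation itv_inv n := (`[n.+2%:R^-1, n.+2%:R]%classic : set R).
Implicit Types (s t x : R).

(* [R] and [measurableTypeR R] carry the same sigma-algebra with different displays;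
   [lebesgue_measure] lives on the latter. *)
Lemma measurable_itv_gt0 : measurable (`]0, +oo[ : set (measurableTypeR R)).
Proof. exact: measurable_itv. Qed.

Lemma measurable_fun_powR_expR (D : set R) s : measurable_fun D (fun t : R => t `^ s * expR (- t)).
Proof.
apply: measurable_funTS; apply: measurable_funM; first exact: measurable_powR.
by apply: measurableT_comp; [exact: measurable_expR|exact: oppr_measurable].
Qed.

Lemma bigcup_itv_inv : \bigcup_n itv_inv n = `]0%R, +oo[%classic.
Proof.
apply/seteqP; split => [x [n _]|x] /=.
  by rewrite !in_itv/= andbT => /andP[+ _]; apply: lt_le_trans; rewrite invr_gt0.
rewrite in_itv/= andbT => x0; exists (Num.truncn x + Num.truncn x^-1)%N => //=.
have h1 := truncnS_gt x; have h2 := truncnS_gt x^-1.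
rewrite in_itv/=; apply/andP; split.
  rewrite -[leRHS]invrK lef_pV2 ?posrE ?invr_gt0//.
  by rewrite (le_trans (ltW h2))// ler_nat -addnS -addSn leq_addl.
by rewrite (le_trans (ltW h1))// ler_nat -!addSn addSnnS leq_addr.
Qed.

Lemma ge0_cvg_integral_itv_inv (f : R -> R) :
  measurable_fun (`]0%R, +oo[ : set R) f -> (forall x, 0 < x -> 0 <= f x) ->
  (\int[mu]_(x in itv_inv n) (f x)%:E @[n --> \oo] -->
   \int[mu]_(x in `]0%R, +oo[) (f x)%:E)%E.
Proof.
move=> mf f0; rewrite -bigcup_itv_inv.
have sub n x : itv_inv n x -> 0 < x.
  by rewrite /= in_itv/= => /andP[+ _]; apply: lt_le_trans; rewrite invr_gt0.
apply: ge0_nondecreasing_set_cvg_integral => //.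
- move=> m n mn; apply/subsetPset => x /=; rewrite !in_itv/= => /andP[h1 h2].
  by rewrite (le_trans _ h1) ?(le_trans h2) ?ler_nat// lef_pV2 ?posrE// ler_nat.
- move=> n; apply/measurable_EFinP; apply: measurable_funS mf => // x /sub x0.
  by rewrite /= in_itv/= x0.
- by move=> n x /sub x0; rewrite lee_fin f0.
Qed.

Lemma derivable_itv_oo_LRcontinuous (F : R -> R) (a b : R) : a <= b ->
  {in `[a, b], forall x, derivable F x 1} -> derivable_oo_LRcontinuous F a b.
Proof.
move=> ab dF; split.
- by move=> x /subset_itv_oo_cc; exact: dF.
- apply: cvg_at_right_filter; apply/differentiable_continuous/derivable1_diffP.
  by apply: dF; rewrite in_itv/= lexx ab.
- apply: cvg_at_left_filter; apply/differentiable_continuous/derivable1_diffP.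
  by apply: dF; rewrite in_itv/= lexx ab.
Qed.

Lemma Gamma_integral_by_parts s (a b : R) : 0 <= s -> 0 < a -> a < b ->
  (\int[mu]_(t in `[a, b]) (t `^ s * expR (- t))%:E =
   (a `^ s * expR (- a) - b `^ s * expR (- b))%:E +
   s%:E * \int[mu]_(t in `[a, b]) (t `^ (s - 1) * expR (- t))%:E)%E.
Proof.
move=> s0 a0 ab.
have pos x : x \in `[a, b] -> 0 < x.
  by rewrite in_itv/= => /andP[+ _]; apply: lt_le_trans.
have dexp x : is_derive x 1 (fun t : R => - expR (- t)) (expR (- x)).
  by apply: is_derive_eq; rewrite mulrN1 opprK.
have dpow x : 0 < x -> is_derive x 1 (fun t : R => t `^ s) (s * x `^ (s - 1)).
  by move=> x0; exact: is_derive1_powR.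
rewrite (@integration_by_parts _ (fun t => t `^ s) (fun t => - expR (- t))
  (fun t => s * t `^ (s - 1)) (fun t => expR (- t)))//.
- rewrite !mulrN opprK (addrC (- _)); congr (_ + _)%E.
  rewrite -ge0_integralZl_EFin//; last 2 first.
    by move=> x _; rewrite lee_fin mulr_ge0 ?powR_ge0 ?expR_ge0.
    by apply/measurable_EFinP; exact: measurable_fun_powR_expR.
  rewrite -[RHS]oppeK -integral_ge0N; last first.
    by move=> x _; rewrite -EFinM lee_fin !mulr_ge0 ?powR_ge0 ?expR_ge0.
  congr (- _)%E; apply: eq_integral => x _.
  by rewrite -EFinM -EFinN mulrN mulrA.
- apply: derivable_within_continuous => x /pos x0.
  apply: derivableM; first exact: derivable_cst.
  by apply: derivable_powR; rewrite in_itv/= x0.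
- apply: derivable_itv_oo_LRcontinuous; first exact: ltW.
  by move=> x /pos x0; apply: derivable_powR; rewrite in_itv/= x0.
- by move=> x /subset_itv_oo_cc /pos x0; rewrite derive1E; have [_ ->] := dpow x x0.
- by apply: derivable_within_continuous => x _; apply: ex_derive.
- apply: derivable_itv_oo_LRcontinuous; first exact: ltW.
  by move=> x _; have [] := dexp x.
- by move=> x _; rewrite derive1E; have [_ ->] := dexp x.
Qed.

(** Integration by parts on compact intervals, whose boundary terms vanish in the limit. The
    identity is kept in the extended reals, before integrability is known, so that it can carry
    finiteness from the exponent [s] to [s - 1]. *)
Lemma Gamma_integral_rec s : 0 < s ->
  (\int[mu]_(t in `]0%R, +oo[) (t `^ s * expR (- t))%:E =
   s%:E * \int[mu]_(t in `]0%R, +oo[) (t `^ (s - 1) * expR (- t))%:E)%E.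
Proof.
move=> s0.
have pos p x : 0 < x -> 0 <= x `^ p * expR (- x).
  by move=> x0; rewrite mulr_ge0 ?powR_ge0 ?expR_ge0.
have h1 := ge0_cvg_integral_itv_inv (@measurable_fun_powR_expR `]0%R, +oo[ s) (pos s).
have h2 := ge0_cvg_integral_itv_inv (@measurable_fun_powR_expR `]0%R, +oo[ (s - 1)) (pos (s - 1)).
have cn : n.+2%:R @[n --> \oo] --> (+oo : set_system R).
  have := @cvgr_idn R; rewrite -(cvg_shiftn 2); apply: cvg_trans.
  by apply: near_eq_cvg; near=> n; rewrite /= addn2.
have hB : ((n.+2%:R^-1 `^ s * expR (- n.+2%:R^-1) -
    n.+2%:R `^ s * expR (- n.+2%:R) : R)%:E @[n --> \oo] --> 0%:E)%E.
  apply: cvg_EFin; first exact: nearW.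
  rewrite -[X in _ --> X]subr0; apply: cvgB; last first.
    by apply: cvg_powR_expR => //; exact: ltW.
  rewrite -[X in _ --> X](mul0r (expR (- 0))); apply: cvgM.
    apply: cvg_near_eq (cvgVy_powR s0 cn); near=> n.
    by rewrite -powR_inv1// -powRrM mulN1r.
  apply: cvg_expR; apply: cvgN; apply/gtr0_cvgV0 => //; exact: nearW.
have sfin : s%:E \is a fin_num by [].
have zfin : 0%:E \is a @fin_num R by [].
have h3 := cvgeD (fin_num_adde_defr _ zfin) hB (cvgeZl sfin h2).
rewrite add0e in h3.
have E n : (\int[mu]_(x in itv_inv n) (x `^ s * expR (- x))%:E =
    (n.+2%:R^-1 `^ s * expR (- n.+2%:R^-1) - n.+2%:R `^ s * expR (- n.+2%:R))%:E +
    s%:E * \int[mu]_(x in itv_inv n) (x `^ (s - 1) * expR (- x))%:E)%E.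
  rewrite Gamma_integral_by_parts ?(ltW s0)//.
  by rewrite (@lt_trans _ _ 1)// ?invf_lt1// ltr1n.
have h4 : (\int[mu]_(x in itv_inv n) (x `^ s * expR (- x))%:E @[n --> \oo] -->
    s%:E * \int[mu]_(x in `]0%R, +oo[) (x `^ (s - 1) * expR (- x))%:E)%E.
  under eq_fun => n do rewrite E.
  exact: h3.
exact: (cvg_unique (@ereal_hausdorff R) h1 h4).
Unshelve. all: by end_near. Qed.

(** A nonnegative exponent is dominated by an exponential density. For [s < 1] the integrand is
    singular at 0; there the recursion helps, since an infinite integral times [s > 0] would make
    the integral with exponent [s] infinite. *)
Lemma integrable_Gamma s : 0 < s ->
  mu.-integrable `]0%R, +oo[ (EFin \o (fun t : R => t `^ (s - 1) * expR (- t))).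
Proof.
have pos p x : 0 <= x `^ p * expR (- x) by rewrite mulr_ge0 ?powR_ge0 ?expR_ge0.
have ge1 p : 0 <= p ->
    mu.-integrable `]0%R, +oo[ (EFin \o (fun t : R => t `^ p * expR (- t))).
  move=> p0; have h0 : 0 < 2^-1 :> R by rewrite invr_gt0.
  have [C HC] := powR_expR_bounded p0 h0.
  (* The factor 2 cancels the rate 1/2 in front of the density; half of the exponential decay is
     spent on bounding [t^p]. *)
  have ie := integrableZl measurableT (C * 2) (integrable_exponential_pdf h0).
  have ie' := @integrableS _ _ _ mu setT `]0%R, +oo[%classic _ measurableT
    (measurable_itv _) (@subsetT _ _) ie.
  apply: le_integrable ie' => //.
    by apply/measurable_EFinP; exact: measurable_fun_powR_expR.
  move=> x /=; rewrite in_itv/= andbT => x0.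
  rewrite lee_fin ger0_norm// exponential_pdfE ?(ltW x0)//.
  rewrite mulrA -(mulrA C) mulfV// mulr1 ger0_norm; last first.
    have := HC _ x0; rewrite mulNr => h; rewrite mulr_ge0 ?expR_ge0//.
    by apply: le_trans h; rewrite mulr_ge0 ?powR_ge0 ?expR_ge0.
  have -> : expR (- x) = expR (- (2^-1 * x)) * expR (- (2^-1 * x)).
    by rewrite -expRD; congr expR; field.
  by rewrite mulrA mulNr ler_wpM2r ?expR_ge0// HC.
move=> s0; apply/integrableP; split.
  by apply/measurable_EFinP; exact: measurable_fun_powR_expR.
under eq_integral do rewrite /= ger0_norm//.
have /integrable_lty := ge1 _ (ltW s0).
rewrite Gamma_integral_rec//; set I := (X in (_ * X)%E) => h; rewrite -/I.
have : (0 <= \int[mu]_(t in `]0%R, +oo[) (t `^ (s - 1) * expR (- t))%:E)%E.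
  by apply: integral_ge0 => x _; rewrite lee_fin.
rewrite -/I; move: h => /(_ measurable_itv_gt0); case: I => [r _ _| |//]; first exact: ltry.
by rewrite gt0_muley ?lte_fin.
Qed.

Lemma Gamma_rec s : 0 < s -> Gamma (s + 1) = s * Gamma s.
Proof.
move=> s0; rewrite /Gamma /Rintegral addrK Gamma_integral_rec// fineM//.
by apply: integrable_fin_num => //; exact: integrable_Gamma.
Qed.

Lemma Rintegral_gt0 (f : R -> R) :
  mu.-integrable `]0%R, +oo[ (EFin \o f) -> (forall x, 0 < x -> 0 < f x) ->
  0 < \int[mu]_(x in `]0%R, +oo[) f x.
Proof.
move=> fi f0.
have f0' x : `]0%R, +oo[%classic x -> 0 < f x by rewrite /= in_itv/= andbT; exact: f0.
rewrite lt_neqAle Rintegral_ge0 ?andbT; last by move=> x /f0' /ltW.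
apply/eqP => /esym I0.
have : (\int[mu]_(x in `]0%R, +oo[) `|(EFin \o f) x| = 0)%E.
  transitivity (\int[mu]_(x in `]0%R, +oo[) (f x)%:E)%E.
    by apply: eq_integral => x; rewrite inE => /f0' /ltW /ger0_norm /= ->.
  by rewrite -[LHS]fineK ?integrable_fin_num// -[fine _]/(Rintegral _ _ _) I0.
move/(ae_eq_integral_abs mu measurable_itv_gt0 (measurable_int _ fi)).1 => [N [mN N0 sub]].
(* A zero integral would force [f = 0] almost everywhere, so the null set [N] would contain the unit
   interval. *)
have : (mu `]0%R, 1%R[ <= mu N)%E.
  apply: le_measure; rewrite ?inE//= => x x01; apply: sub => /= h.
  have x0 : `]0%R, +oo[%classic x by move: x01; rewrite /= !in_itv/= andbT => /andP[].
  by have := f0' _ x0; case: (h x0) => ->; rewrite ltxx.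
by rewrite N0 lebesgue_measure_itv/= lte_fin ltr01 sube0 lee_fin ler10.
Qed.

Lemma Gamma_gt0 s : 0 < s -> 0 < Gamma s.
Proof.
move=> s0; apply: Rintegral_gt0; first exact: integrable_Gamma.
by move=> x x0; rewrite mulr_gt0 ?powR_gt0 ?expR_gt0.
Qed.

(** Convexity of [expR] between [ln x] and 0 with weights [th] and [1 - th]. *)
Lemma powR_le_tangent (th x : R) : 0 <= th <= 1 -> 0 < x -> x `^ th <= 1 - th + th * x.
Proof.
move=> /andP[th0 th1] x0.
have := @convex_expR R (Itv01 th0 th1) (ln x) 0.
by rewrite !convRE/= expR0 lnK ?posrE// mulr0 addr0 mulr1 /powR gt_eqF// addrC.
Qed.

(* Integrating the tangent line of [t `^ th] at [t = s] against the density of [Gamma s]. *)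
Lemma Gamma_add_le s (th : R) : 0 < s -> 0 <= th <= 1 ->
  Gamma (s + th) <= s `^ th * Gamma s.
Proof.
move=> s0 /andP[th0 th1]; have sth : 0 < s + th by rewrite ltr_pwDl.
have i1 := integrable_Gamma s0.
have i2 : mu.-integrable `]0%R, +oo[ (EFin \o (fun t : R => t `^ s * expR (- t))).
  by have := @integrable_Gamma (s + 1) (addr_gt0 s0 ltr01); rewrite addrK.
have j1 := integrableZl measurable_itv_gt0 (s `^ th * (1 - th)) i1.
have j2 := integrableZl measurable_itv_gt0 (s `^ th * (th / s)) i2.
(* Since [t^s] integrates to [s * Gamma s], the two terms contribute the fractions [1 - th] and [th]
   of [s^th * Gamma s]. *)
apply: (@le_trans _ _ (\int[mu]_(t in `]0%R, +oo[)
  (s `^ th * (1 - th) * (t `^ (s - 1) * expR (- t)) +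
   s `^ th * (th / s) * (t `^ s * expR (- t))))).
  apply: le_Rintegral => //; first exact: integrable_Gamma.
    exact: (integrableD measurable_itv_gt0 j1 j2).
  move=> t /=; rewrite in_itv/= andbT => t0.
  have -> : s + th - 1 = (s - 1) + th by ring.
  rewrite powRD; last by rewrite (gt_eqF t0) implybT.
  have -> : t `^ s = t `^ (s - 1) * t.
    by rewrite -{3}(powRr1 (ltW t0)) -powRD ?subrK// (gt_eqF t0) implybT.
  rewrite (_ : t `^ th = s `^ th * (t / s) `^ th); last first.
    by rewrite -powRM ?divr_ge0 ?(ltW s0) ?(ltW t0)// mulrCA mulfV ?gt_eqF// mulr1.
  have h := @powR_le_tangent th (t / s) (introT andP (conj th0 th1)) (divr_gt0 t0 s0).
  have c0 : 0 <= s `^ th * (t `^ (s - 1) * expR (- t)).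
    by rewrite !mulr_ge0 ?powR_ge0 ?expR_ge0.
  have s0' : s != 0 by rewrite gt_eqF.
  have := ler_wpM2l c0 h; set A := t `^ (s - 1); set B := s `^ th.
  set C := (t / s) `^ th; set D := expR (- t) => hc.
  have -> : A * (B * C) * D = B * (A * D) * C by ring.
  apply: le_trans hc _; rewrite le_eqVlt; apply/orP; left; apply/eqP; field.
  exact: s0'.
rewrite RintegralD//= !RintegralZl//.
have -> : \int[mu]_(t in `]0%R, +oo[) (t `^ s * expR (- t)) = s * Gamma s.
  by rewrite -Gamma_rec// /Gamma addrK.
rewrite -/(Gamma s) le_eqVlt; apply/orP; left; apply/eqP; field.
by rewrite gt_eqF.
Qed.

(** For [delta <= 1], [Gamma_add_le] is used twice, from [k] to [k + delta] and from [k + delta] to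
    [k + 1]; this places the expression between [((k + delta) / k)^(delta - 1)] and 1. Larger
    [delta] descend by unit steps, each costing a factor that tends to 1. *)
Lemma cvg_Gamma_ratio (delta : R) : 0 < delta ->
  Gamma (k%:R + delta) / Gamma (k%:R + 1) * k%:R `^ (1 - delta) @[k --> \oo] --> (1 : R).
Proof.
suff H n (d : R) : 0 < d <= n.+1%:R ->
    Gamma (k%:R + d) / Gamma (k%:R + 1) * k%:R `^ (1 - d) @[k --> \oo] --> (1 : R).
  by move=> d0; apply: (H (Num.truncn delta)); rewrite d0 ltW// truncnS_gt.
have kd (e : R) : (k%:R + e) / k%:R @[k --> \oo] --> (1 : R).
  rewrite -[X in _ --> X]addr0 -[X in 1 + X](mulr0 e).
  have h : 1 + e * k%:R^-1 @[k --> \oo] --> (1 + e * 0 : R).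
    apply: cvgD; first exact: cvg_cst.
    apply: cvgMr; apply/gtr0_cvgV0; last exact: cvgr_idn.
    by exists 1%N => // k /=; rewrite ltr0n.
  apply: cvg_trans h; apply: near_eq_cvg; near=> k.
  have k0 : (k%:R : R) != 0.
    by rewrite pnatr_eq0 -lt0n; near: k; exists 1%N.
  by rewrite mulrDl mulfV.
have small (e : R) : 0 < e -> e <= 1 ->
    Gamma (k%:R + e) / Gamma (k%:R + 1) * k%:R `^ (1 - e) @[k --> \oo] --> (1 : R).
  move=> e0 e1.
  have d1 : 0 <= e <= 1 by rewrite ltW.
  have h : ((k%:R + e) / k%:R) `^ (e - 1) @[k --> \oo] --> (1 : R).
    have E1 : 1 `^ (e - 1) = 1 :> R by rewrite powR1.
    by rewrite -[X in _ --> X]E1; exact: cvg_powR ltr01 (kd e).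
  have h1 : (fun _ : nat => 1 : R) @ \oo --> (1 : R) by exact: cvg_cst.
  apply: squeeze_cvgr h h1; near=> k.
  have k0 : 0 < k%:R :> R by rewrite ltr0n; near: k; exists 1%N.
  have kd0 : 0 < k%:R + e by rewrite addr_gt0.
  have G1 := Gamma_gt0 k0; have Gd := Gamma_gt0 kd0.
  have h1 := Gamma_add_le k0 d1.
  have h2 : Gamma (k%:R + 1) <= (k%:R + e) `^ (1 - e) * Gamma (k%:R + e).
    have -> : k%:R + 1 = k%:R + e + (1 - e) :> R by ring.
    by apply: Gamma_add_le => //; rewrite subr_ge0 lerBlDr lerDl; apply/andP; split; case/andP: d1.
  have kp : 0 < k%:R `^ (1 - e) :> R by rewrite powR_gt0.
  apply/andP; split.
    have -> : e - 1 = - (1 - e) by rewrite opprB.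
    rewrite powRN powRM ?invr_ge0 ?(ltW k0) ?(ltW kd0)//.
    have -> : k%:R^-1 `^ (1 - e) = (k%:R `^ (1 - e))^-1.
      by rewrite -powR_inv1 ?(ltW k0)// -powRrM mulN1r powRN.
    rewrite invfM invrK.
    rewrite ler_wpM2r ?(ltW kp)// ler_pdivlMr ?Gamma_gt0 ?addr_gt0//.
    by rewrite mulrC ler_pdivrMr ?powR_gt0// mulrC.
  rewrite Gamma_rec// mulrAC ler_pdivrMr ?mulr_gt0// mul1r.
  apply: le_trans (ler_wpM2r (ltW kp) h1) _.
  by rewrite mulrAC -powRD ?subrKC ?powRr1 ?(ltW k0)// gt_eqF ?implybT.
elim: n d => [|n IH] d /andP[d0 dn]; last first.
  have [d1|d1] := leP d 1; first exact: small.
  have := IH (d - 1); rewrite subr_gt0 d1 lerBlDr natr1 => /(_ dn) h.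
  have h2 := cvgM h (kd (d - 1)); rewrite mulr1 in h2.
  apply: (@cvg_near_eq R nat \oo _ (fun k => Gamma (k%:R + (d - 1)) / Gamma (k%:R + 1)
    * k%:R `^ (1 - (d - 1)) * ((k%:R + (d - 1)) / k%:R))); last exact: h2.
  near=> k.
  have k0 : 0 < k%:R :> R by rewrite ltr0n; near: k; exists 1%N.
  have -> : Gamma (k%:R + d) = (k%:R + (d - 1)) * Gamma (k%:R + (d - 1)).
    by rewrite -Gamma_rec ?addrA ?subrK// -addrA addr_gt0// subr_gt0.
  have -> : 1 - (d - 1) = 1 - d + 1 by ring.
  rewrite powRD ?powRr1 ?(ltW k0)//; last by rewrite (gt_eqF k0) implybT.
  by field; rewrite !gt_eqF// Gamma_gt0// addr_gt0.
exact: small.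
Unshelve. all: by end_near. Qed.
End GammaFunction.

(** * Independence and densities *)

Section Independence.
Context {d : measure_display} {Om : measurableType d} {R : realType} (P : probability Om R).
Context {d0 : measure_display} {T0 : measurableType d0} {d1 : measure_display} {E : measurableType d1}
  {d2 : measure_display} {E' : measurableType d2}.
Variables (Z : {mfun Om >-> T0}) (U : {mfun Om >-> E}) (U' : {mfun Om >-> E'}).
Local Open Scope ereal_scope.
Hypothesis indep : forall (A : set T0) (C : set E) (C' : set E'),
  measurable A -> measurable C -> measurable C' ->
  P (Z @^-1` A `&` U @^-1` C `&` U' @^-1` C')
  = P (Z @^-1` A) * P (U @^-1` C) * P (U' @^-1` C').

Let measurable_preim d' (T' : measurableType d') (X : {mfun Om >-> T'}) A :
  measurable A -> measurable (X @^-1` A).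
Proof. by move=> mA; rewrite -[X in measurable X]setTI; exact: measurable_funP. Qed.

Let mUU' : measurable_fun setT (fun om => (U om, U' om)).
Proof. exact: measurable_fun_pair. Qed.

Let mZUU' : measurable_fun setT (fun om => (Z om, (U om, U' om))).
Proof. by apply: measurable_fun_pair. Qed.

(** For fixed [A] both sides are measures in [W] that agree on rectangles, hence everywhere by
    uniqueness of the product measure. *)
Lemma probability_indep_pair (A : set T0) (W : set (E * E')) :
  measurable A -> measurable W ->
  P (Z @^-1` A `&` (fun om => (U om, U' om)) @^-1` W) =
  P (Z @^-1` A) * (distribution P U \x distribution P U') W.
Proof.
move=> mA mW.
have mZA := measurable_preim Z mA.
(* The constant [P (Z in A)] is absorbed into the first factor, so that the right-hand side becomes
   a product of two measures. *)
pose c : {nonneg R} := NngNum (fine_ge0 (measure_ge0 P (Z @^-1` A))).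
have cE : c%:num%:E = P (Z @^-1` A) by rewrite /= fineK// fin_num_measure.
pose m1 := mscale c (distribution P U).
pose f : {mfun Om >-> (E * E')%type} := HB.pack (fun om => (U om, U' om))
  (isMeasurableFun.Build _ _ _ _ _ mUU').
pose m0 := [the measure _ _ of pushforward (mrestr P mZA) f].
pose m' := m0 mUU'.
have h : forall (C : set E) (C' : set E'), measurable C -> measurable C' ->
    m' (C `*` C') = m1 C * distribution P U' C'.
  move=> C C' mC mC'.
  transitivity (P (Z @^-1` A) * P (U @^-1` C) * P (U' @^-1` C')); last first.
    by rewrite /m1 /mscale /= cE.
  rewrite -indep// /m' /m0 /= /pushforward /mrestr; congr (P _).
  by apply/seteqP; split => x /=; tauto.
have := product_measure_unique h mW.
rewrite /m' /= /pushforward /mrestr /= setIC => <-.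
rewrite /product_measure1 ge0_integral_mscale//=.
- by rewrite cE.
- exact: measurable_fun_xsection.
Qed.

(** Conditioning on [Z]: the joint law is the product of the law of [Z] and that of [(U, U')], and
    the section of the event at [z] is a rectangle, whose probability factors. *)
Lemma probability_indep3 (A : set (T0 * E)) (A' : set (T0 * E')) :
  measurable A -> measurable A' ->
  P [set om | A (Z om, U om) /\ A' (Z om, U' om)] =
  \int[distribution P Z]_z (P (U @^-1` xsection A z) * P (U' @^-1` xsection A' z)).
Proof.
move=> mA mA'.
pose X : set (T0 * (E * E')) := [set x | A (x.1, x.2.1) /\ A' (x.1, x.2.2)].
have mX : measurable X.
  have -> : X = (fun x => (x.1, x.2.1)) @^-1` A `&` (fun x => (x.1, x.2.2)) @^-1` A' by [].
  have mp1 : measurable_fun setT (fun x : T0 * (E * E') => (x.1, x.2.1)).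
    apply: measurable_fun_pair; first exact: measurable_fst.
    exact: (measurableT_comp measurable_fst measurable_snd).
  have mp2 : measurable_fun setT (fun x : T0 * (E * E') => (x.1, x.2.2)).
    apply: measurable_fun_pair; first exact: measurable_fst.
    exact: (measurableT_comp measurable_snd measurable_snd).
  apply: measurableI; rewrite -[X in measurable X]setTI; [exact: mp1|exact: mp2].
pose f : {mfun Om >-> (T0 * (E * E'))%type} := HB.pack (fun om => (Z om, (U om, U' om)))
  (isMeasurableFun.Build _ _ _ _ _ mZUU').
pose Q : probability (E * E')%type R :=
  [the probability _ _ of (distribution P U \x distribution P U')%E].
have h : forall (B : set T0) (W : set (E * E')), measurable B -> measurable W ->
    distribution P f (B `*` W) = distribution P Z B * Q W.
  by move=> B W mB mW; rewrite /distribution /pushforward /= -probability_indep_pair.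
have hX := product_measure_unique (m1 := distribution P Z) (m2 := Q) (m' := distribution P f) h mX.
transitivity (distribution P f X) => //; rewrite -hX /=.
rewrite [LHS]/product_measure1; apply: eq_integral => z _ /=.
have -> : xsection X z = xsection A z `*` xsection A' z.
  by apply/seteqP; split => -[u u']; rewrite /xsection /= !inE.
by rewrite product_measure1E//; exact: measurable_xsection.
Qed.

End Independence.

Section Density.
Context {d : measure_display} {T : measurableType d} {R : realType} (mu : {measure set T -> \bar R}).
Local Open Scope ereal_scope.
Variable g : T -> R.
Hypotheses (g0 : forall x, (0 <= g x)%R) (mg : measurable_fun setT g).

(** Packages the integral of [g] as a measure, so that uniqueness theorems for measures apply to
    it. *)
Lemma density_measure : exists nu : {measure set T -> \bar R},
  forall A, nu A = \int[mu]_(x in A) (g x)%:E.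
Proof.
pose nu (A : set T) := \int[mu]_(x in A) (g x)%:E.
have nu0 : nu set0 = 0 by rewrite /nu integral_set0.
have nu_ge0 A : 0 <= nu A by apply: integral_ge0 => x _; rewrite lee_fin.
have nu_sa : semi_sigma_additive nu.
  move=> /= F mF tF mUF; rewrite /nu; apply: cvg_toP.
    apply: ereal_nondecreasing_is_cvgn => m n mn.
    by apply: lee_sum_nneg_natr => // k _ _; exact: nu_ge0.
  rewrite ge0_integral_bigcup//=.
    by apply/measurable_funTS/measurable_EFinP.
  by move=> x _; rewrite lee_fin.
pose nu' : {measure set T -> \bar R} := HB.pack nu (isMeasure.Build _ _ _ nu nu0 nu_ge0 nu_sa).
by exists nu'.
Qed.

Import HBNNSimple.

(** The values of [nu] are prescribed on measurable sets only, so [nu] may be a distribution whose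
    density has been identified there. *)
Lemma ge0_integral_density (nu : {measure set T -> \bar R}) (f : T -> \bar R) (D : set T) :
  (forall A, measurable A -> nu A = \int[mu]_(x in A) (g x)%:E) ->
  measurable D -> measurable_fun D f -> (forall x, D x -> 0 <= f x) ->
  \int[nu]_(x in D) f x = \int[mu]_(x in D) (f x * (g x)%:E).
Proof.
move=> nuE mD mf f0.
pose h := nnsfun_approx mD mf.
have mgE (A : set T) : measurable_fun A (EFin \o g) by apply/measurable_funTS/measurable_EFinP.
have -> : \int[nu]_(x in D) f x = lim (\int[nu]_(x in D) (EFin \o h n) x @[n --> \oo]).
  have fE x : D x -> f x = lim ((EFin \o h n) x @[n --> \oo]).
    by move=> Dx; apply/esym/cvg_lim => //; exact: cvg_nnsfun_approx.
  under eq_integral => x /[!inE] /fE -> //.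
  apply: monotone_convergence => //.
  - by move=> n; apply/measurable_EFinP/measurable_funTS.
  - by move=> n x Dx //=; rewrite lee_fin.
  - by move=> x Dx a b ab; rewrite lee_fin; exact/lefP/nd_nnsfun_approx.
have -> : \int[mu]_(x in D) (f x * (g x)%:E) =
    lim (\int[mu]_(x in D) ((EFin \o h n) x * (g x)%:E) @[n --> \oo]).
  have fg x : D x -> f x * (g x)%:E = lim ((EFin \o h n) x * (g x)%:E @[n --> \oo]).
    by move=> Dx; apply/esym/cvg_lim => //; apply: cvgeZr => //; exact: cvg_nnsfun_approx.
  under eq_integral => x /[!inE] /fg -> //.
  apply: monotone_convergence => //.
  - by move=> n; apply: emeasurable_funM => //; apply/measurable_EFinP/measurable_funTS.
  - by move=> n x Dx /=; rewrite mule_ge0 ?lee_fin.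
  - by move=> x Dx a b ab/=; rewrite lee_wpmul2r ?lee_fin//; exact/lefP/nd_nnsfun_approx.
(* Both sides are limits along the same simple functions, so they are compared for fixed [n], value
   by value on the level sets. *)
apply/congr_lim/funext => n.
transitivity (\int[nu]_(x in D) (\sum_(y \in range (h n)) (y * \1_(h n @^-1` [set y]) x)%:E)).
  by apply: eq_integral => t tD; rewrite /= fimfunE -fsumEFin.
rewrite ge0_integral_fsum//; last 2 first.
- by move=> y; apply/measurable_EFinP; apply: measurable_funM => //; apply: measurable_funTS.
- by move=> m y Dy; exact: nnfun_muleindic_ge0.
transitivity (\int[mu]_(x in D) (\sum_(y \in range (h n))
    (y * \1_(h n @^-1` [set y]) x)%:E * (g x)%:E)); last first.
  apply: eq_integral => x xD.
  rewrite -ge0_mule_fsuml => [|y]; last exact: nnfun_muleindic_ge0.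
  by rewrite fsumEFin// -(fimfunE _ x).
rewrite ge0_integral_fsum//; last 2 first.
- move=> y; apply: emeasurable_funM => //; apply/measurable_EFinP.
  by apply: measurable_funM => //; apply: measurable_funTS.
- move=> m y Dy; apply: mule_ge0; last by rewrite lee_fin.
  exact: nnfun_muleindic_ge0.
apply: eq_fsbigr => r rhn.
under eq_integral do rewrite EFinM.
rewrite integralZl_indic_nnsfun => //.
under [RHS]eq_integral do rewrite EFinM -muleA.
rewrite ge0_integralZl//.
- under [in RHS]eq_integral do rewrite muleC.
  rewrite [in RHS](eq_integral ((EFin \o g) \_ (h n @^-1` [set r]))); last first.
    by move=> x xE; rewrite epatch_indic.
  by rewrite -integral_mkcondr -nuE ?integral_indic// setIC.
- by apply: emeasurable_funM => //; apply/measurable_EFinP/measurable_funTS.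
- by move=> t Et; rewrite mule_ge0 ?lee_fin.
- by move: rhn; rewrite inE => -[t _ <-]; rewrite lee_fin.
Qed.

End Density.

(** * The Pareto law *)

Section ParetoLaw.
Context {R : realType}.
Local Notation mu := (@lebesgue_measure R).
Implicit Types (th s x : R).

Lemma cvg_powRN_pinfty th : 0 < th -> x `^ (- th) @[x --> +oo] --> (0 : R).
Proof. by move=> th0; apply: cvgVy_powR => //; exact: cvg_id. Qed.

Lemma measurable_powR_tail (D : set R) th : measurable_fun D (fun w : R => th * w `^ (- th - 1)).
Proof. by apply: measurable_funTS; apply: measurable_funM => //; exact: measurable_powR. Qed.

Lemma integral_powR_tail th x : 0 < th -> 0 < x ->
  (\int[mu]_(w in `]x%R, +oo[) (th * w `^ (- th - 1))%:E = (x `^ (- th))%:E)%E.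
Proof.
move=> th0 x0.
rewrite integral_itv_obnd_cbnd; last first.
  by apply/measurable_EFinP; exact: measurable_powR_tail.
have pos w : x <= w -> 0 < w by apply: lt_le_trans.
rewrite (@ge0_continuous_FTC2y _ _ (fun w => - w `^ (- th)) x 0).
- by rewrite EFinN oppeK add0e.
- by move=> w xw; rewrite mulr_ge0 ?powR_ge0// ltW.
- apply: derivable_within_continuous => w; rewrite in_itv/= andbT => /pos w0.
  apply: derivableM; first exact: derivable_cst.
  by apply: derivable_powR; rewrite in_itv/= w0.
- by rewrite -oppr0; apply: cvgN; exact: cvg_powRN_pinfty.
- move=> w /ltW /pos w0; apply: derivableN.
  by apply: derivable_powR; rewrite in_itv/= w0.
- apply: cvg_at_right_filter; apply: cvgN; exact: powR_continuous.
- move=> w; rewrite in_itv/= andbT => /ltW /pos w0.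
  rewrite derive1E deriveN; last by apply: derivable_powR; rewrite in_itv/= w0.
  by have [_ ->] := is_derive1_powR (- th) w0; rewrite mulNr opprK.
Qed.

(** Open upper rays are stable under intersection, generate the Borel sets and exhaust the line, so
    a finite tail function determines the measure. *)
Lemma measure_unique_itv_oy (m1 m2 : {measure set (measurableTypeR R) -> \bar R}) :
  (forall x, m1 `]x, +oo[%classic = m2 `]x, +oo[%classic) ->
  (forall x, m1 `]x, +oo[%classic < +oo)%E ->
  forall A : set (measurableTypeR R), measurable A -> m1 A = m2 A.
Proof.
move=> m12 m1oo A mA.
apply: (@measure_unique _ R (measurableTypeR R) (@RGenOInfty.G R) (fun n => `](- n%:R)%R, +oo[%classic)) => //.
- exact: RGenOInfty.measurableE.
- move=> _ _ [x ->] [y ->]; exists (Num.max x y).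
  by apply/seteqP; split => z /=; rewrite !in_itv/= !andbT gt_max; [case=> -> ->|move=> /andP[]].
- by move=> n; exists (- n%:R).
- apply/seteqP; split => // x _; exists (Num.truncn `|x|).+1 => //=.
  rewrite in_itv/= andbT ltrNl; apply: le_lt_trans (truncnS_gt `|x|).
  by rewrite -normrN ler_norm.
- by move=> _ [x ->].
Qed.

(* The density of [Z / s] when [P (Z > z) = z^-th] for [z >= 1]: working with [Z / s]
   from the start replaces the change of variables [z = s w]. *)
Definition scaled_pareto_pdf th s : R -> R :=
  (fun w => s `^ (- th) * (th * w `^ (- th - 1))) \_ `]s^-1, +oo[.

Lemma scaled_pareto_pdf_ge0 th s x : 0 < th -> 0 <= scaled_pareto_pdf th s x.
Proof.
move=> th0; apply: restrict_ge0 => {}x _.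
by rewrite mulr_ge0 ?powR_ge0// mulr_ge0 ?powR_ge0// ltW.
Qed.

Lemma measurable_scaled_pareto_pdf th s : measurable_fun setT (scaled_pareto_pdf th s).
Proof.
apply/measurable_restrict => //; apply: measurable_funTS.
apply: measurable_funM => //; apply: measurable_funM => //; exact: measurable_powR.
Qed.

(** The maximum records that the density vanishes below [1/s]; for smaller [x] the value is 1, the
    whole mass. *)
Lemma integral_scaled_pareto_pdf th s x : 0 < th -> 0 < s ->
  (\int[mu]_(w in `]x%R, +oo[) (scaled_pareto_pdf th s w)%:E =
   ((s * Num.max x s^-1) `^ (- th))%:E)%E.
Proof.
move=> th0 s0.
have m0 : 0 < Num.max x s^-1 by rewrite lt_max invr_gt0 s0 orbT.
transitivity (\int[mu]_(w in `](Num.max x s^-1)%R, +oo[) ((s `^ (- th))%:E * (th * w `^ (- th - 1))%:E))%E.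
  have -> : `]Num.max x s^-1, +oo[%classic = `]x, +oo[%classic `&` `]s^-1, +oo[%classic.
    by apply/seteqP; split => z /=; rewrite !in_itv/= !andbT gt_max; [move=> /andP[]|case=> -> ->].
  rewrite integral_mkcondr; apply: eq_integral => w _.
  by rewrite /scaled_pareto_pdf /patch; case: ifPn.
rewrite ge0_integralZl_EFin//=.
- by rewrite integral_powR_tail// -EFinM powRM ?ltW.
- by move=> w _; rewrite lee_fin mulr_ge0 ?powR_ge0// ltW.
- by apply/measurable_EFinP; exact: measurable_powR_tail.
- exact: powR_ge0.
Qed.

Context {d : measure_display} {Om : measurableType d} (P : probability Om R).
Variable Z : {mfun Om >-> measurableTypeR R}.
Variables th s : R.
Hypotheses (th0 : 0 < th) (s0 : 0 < s).
Hypothesis Zlaw : forall z : R, 1 <= z -> P [set om | z < Z om] = (z `^ (- th))%:E.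

Let measurable_gt y : measurable [set om | y < Z om].
Proof.
have -> : [set om | y < Z om] = Z @^-1` `]y, +oo[%classic.
  by apply/seteqP; split => om /=; rewrite in_itv/= andbT.
by rewrite -[X in measurable X]setTI; apply: (measurable_funP Z) => //; exact: measurable_itv.
Qed.

Let mZs : measurable_fun setT ((fun om => Z om / s) : Om -> measurableTypeR R).
Proof.
have mZ : measurable_fun setT (Z : Om -> R) by exact: (measurable_funP Z).
have : measurable_fun setT ((fun om => Z om / s) : Om -> R) by exact: measurable_funM.
exact.
Qed.

(** The law is prescribed for [z >= 1] only. It already gives [P (Z > 1) = 1], which forces
    probability 1 for every smaller [x]. *)
Lemma pareto_tail x : P [set om | x < Z om] = ((Num.max x 1) `^ (- th))%:E.
Proof.
have [x1|x1] := leP 1 x; first exact: Zlaw.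
apply/eqP; rewrite powR1 eq_le; apply/andP; split; first by apply: probability_le1; exact: measurable_gt.
have {1}-> : (1 = P [set om | (1 < Z om)%R])%E by rewrite Zlaw// powR1.
apply: le_measure; rewrite ?inE; try exact: measurable_gt.
by move=> om /=; exact: lt_trans.
Qed.

Lemma pareto_scaled_law (A : set (measurableTypeR R)) : measurable A ->
  P [set om | A (Z om / s)] = (\int[mu]_(w in A) (scaled_pareto_pdf th s w)%:E)%E.
Proof.
move=> mA.
pose Zs : {mfun Om >-> measurableTypeR R} := HB.pack ((fun om => Z om / s) : Om -> measurableTypeR R)
  (isMeasurableFun.Build _ _ _ _ _ mZs).
have [nu nuE] := @density_measure _ _ _ mu (scaled_pareto_pdf th s)
  (fun x => scaled_pareto_pdf_ge0 s x th0) (measurable_scaled_pareto_pdf th s).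
rewrite -nuE; transitivity (distribution P Zs A) => //.
have tail x : distribution P Zs `]x, +oo[%classic = nu `]x, +oo[%classic.
  rewrite nuE integral_scaled_pareto_pdf//.
  rewrite (_ : s * Num.max x s^-1 = Num.max (s * x) 1); last first.
    by rewrite maxr_pMr ?(ltW s0)// mulfV// gt_eqF.
  rewrite -pareto_tail; congr (P _).
  by apply/seteqP; split => om /=; rewrite in_itv/= andbT ltr_pdivlMr// mulrC.
apply: measure_unique_itv_oy => // x.
by rewrite ltey_eq fin_num_measure//; exact: measurable_itv.
Qed.

(** Pulled back to the sample space, the integrals against the laws of [Z] and of [Z / s] coincide;
    the second law is then replaced by its density. *)
Lemma integral_pareto (f : R -> R) :
  measurable_fun setT f -> (forall z, 1 < z -> 0 <= f z) ->
  (\int[distribution P Z]_(z in `]1%R, +oo[) (f z)%:E =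
   \int[mu]_(w in `](s^-1)%R, +oo[) (f (s * w) * (s `^ (- th) * (th * w `^ (- th - 1))))%:E)%E.
Proof.
move=> mf f0.
pose Zs : {mfun Om >-> measurableTypeR R} := HB.pack ((fun om => Z om / s) : Om -> measurableTypeR R)
  (isMeasurableFun.Build _ _ _ _ _ mZs).
have mfs : measurable_fun setT (fun w : R => f (s * w)).
  by apply: (measurableT_comp mf); exact: mulrl_measurable.
have fs0 w : `]s^-1, +oo[%classic w -> 0 <= f (s * w).
  rewrite /= in_itv/= andbT => sw; apply: f0.
  by rewrite -ltr_pdivrMl// mulr1.
transitivity (\int[distribution P Zs]_(w in `](s^-1)%R, +oo[) (f (s * w))%:E)%E.
  rewrite !ge0_integral_pushforward//.
  - have -> : Zs @^-1` `]s^-1, +oo[%classic = Z @^-1` `]1, +oo[%classic.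
      by apply/seteqP; split => om /=; rewrite !in_itv/= !andbT ltr_pdivlMr// mulVf ?gt_eqF.
    by apply: eq_integral => om _ /=; rewrite mulrCA mulfV ?mulr1 ?gt_eqF.
  - by apply/measurable_EFinP; exact: measurable_funTS.
  - by move=> w; rewrite inE lee_fin; exact: fs0.
  - by apply/measurable_EFinP; exact: measurable_funTS.
  - by move=> z; rewrite inE /= in_itv/= andbT lee_fin; exact: f0.
rewrite (@ge0_integral_density _ _ _ mu (scaled_pareto_pdf th s)
  (fun x => scaled_pareto_pdf_ge0 s x th0) (measurable_scaled_pareto_pdf th s)).
- apply: eq_integral => w wD; rewrite -EFinM; congr (_ * _)%:E.
  by rewrite /scaled_pareto_pdf /patch wD.
- by move=> A mA; rewrite -pareto_scaled_law.
- exact: measurable_itv.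
- by apply/measurable_EFinP; exact: measurable_funTS.
- by move=> w wD; rewrite lee_fin fs0.
Qed.

End ParetoLaw.

(** * The mixed negative binomial mass function *)

Section MixturePmf.
Context {R : realType}.
Local Notation mu := (@lebesgue_measure R).
Implicit Types (q z w : R).

Lemma measurable_invr : measurable_fun [set: R] (fun x : R => x^-1).
Proof.
(* A product of measurable functions that agrees with the inverse also at 0, where both sides are
   0. *)
rewrite (_ : (fun x => x^-1) = (fun x : R => x * `|x| `^ (- 2%:R))); last first.
  apply/funext => x; have [->|x0] := eqVneq x 0; first by rewrite invr0 mul0r.
  rewrite powRN powR_mulrn// real_normK ?num_real//; field; exact: x0.
apply: measurable_funM => //.
by apply: (measurableT_comp (measurable_powR _)); exact: normr_measurable.
Qed.

Lemma neg_binomial_pmf_ge0 (delta q : R) i : 0 < delta -> q <= 1 ->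
  0 <= neg_binomial_pmf delta q i.
Proof.
move=> d0 q1.
have i0 : 0 <= i%:R :> R by [].
rewrite /neg_binomial_pmf !mulr_ge0 ?powR_ge0 ?exprn_ge0 ?subr_ge0 ?invr_ge0 ?mulr_ge0//;
  by rewrite ltW// Gamma_gt0// ?ltr_wpDl.
Qed.

Lemma measurable_neg_binomial_pmf (delta : R) i (f : R -> R) :
  measurable_fun setT f -> measurable_fun setT (fun z => neg_binomial_pmf delta (f z) i).
Proof.
move=> mf; apply: measurable_funM; first apply: measurable_funM => //.
  by apply: (measurableT_comp (measurable_powR _)).
by apply: measurable_funX; apply: measurable_funB.
Qed.

Context (c1 a : R) {d : measure_display} {Om : measurableType d} (P : probability Om R)
  {d1 : measure_display} {E : measurableType d1} {d2 : measure_display} {E' : measurableType d2}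
  (Z : Om -> R) (U : Om -> E) (U' : Om -> E') (T : R -> R -> E -> nat) (T' : R -> R -> E' -> nat).
Hypotheses (c10 : 0 < c1) (a0 : 0 < a) (mix : mixing_variables c1 P Z U U' T T').
Variables (delta delta' : R).
Hypotheses (delta0 : 0 < delta) (delta'0 : 0 < delta').

Lemma measurable_mixing_event k l : measurable
  [set om | T delta (Z om)^-1 (U om) = k /\ T' delta' (Z om `^ (- a)) (U' om) = l].
Proof.
have mZ := mix_Z_measurable mix.
have m1 : measurable_fun setT (fun om => T delta (Z om)^-1 (U om)).
  apply: (measurableT_comp (mix_T_measurable mix delta0) (g := fun om => ((Z om)^-1, U om))).
  apply: measurable_fun_pair; last exact: mix_U_measurable mix.
  exact: (measurableT_comp measurable_invr).
have m2 : measurable_fun setT (fun om => T' delta' (Z om `^ (- a)) (U' om)).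
  apply: (measurableT_comp (mix_T'_measurable mix delta'0) (g := fun om => (Z om `^ (- a), U' om))).
  apply: measurable_fun_pair; last exact: mix_U'_measurable mix.
  exact: (measurableT_comp (measurable_powR _)).
apply: (@measurableI _ _ [set om | T delta (Z om)^-1 (U om) = k]).
  by rewrite -[X in measurable X]setTI; exact: (m1 measurableT [set k]).
by rewrite -[X in measurable X]setTI; exact: (m2 measurableT [set l]).
Qed.

(** The left-hand side does not involve [s]: the scale is free and can be matched later to the
    growth of [k] and [l]. *)
Lemma mixture_pmfE (s : R) k l : 0 < s ->
  P [set om | T delta (Z om)^-1 (U om) = k /\ T' delta' (Z om `^ (- a)) (U' om) = l] =
  (\int[mu]_(w in `](s^-1)%R, +oo[)
    (neg_binomial_pmf delta (s * w)^-1 k * neg_binomial_pmf delta' ((s * w) `^ (- a)) l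
     * (s `^ (- c1^-1) * (c1^-1 * w `^ (- c1^-1 - 1))))%:E)%E.
Proof.
move=> s0.
have mZ : measurable_fun setT (Z : Om -> measurableTypeR R) by exact: mix_Z_measurable mix.
pose Zm : {mfun Om >-> measurableTypeR R} := HB.pack (Z : Om -> measurableTypeR R)
  (isMeasurableFun.Build _ _ _ _ _ mZ).
pose Um : {mfun Om >-> E} := HB.pack U (isMeasurableFun.Build _ _ _ _ _ (mix_U_measurable mix)).
pose Um' : {mfun Om >-> E'} := HB.pack U' (isMeasurableFun.Build _ _ _ _ _ (mix_U'_measurable mix)).
have mid : measurable_fun setT ((fun x => x) : measurableTypeR R -> R) by exact: measurable_id.
pose A : set (measurableTypeR R * E) := [set ze | T delta ze.1^-1 ze.2 = k].
pose A' : set (measurableTypeR R * E') := [set ze | T' delta' (ze.1 `^ (- a)) ze.2 = l].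
have mA : measurable A.
  have m : measurable_fun setT (fun ze : measurableTypeR R * E => T delta ze.1^-1 ze.2).
    apply: (measurableT_comp (mix_T_measurable mix delta0)
      (g := fun ze : measurableTypeR R * E => (ze.1^-1, ze.2))).
    apply: measurable_fun_pair; last exact: measurable_snd.
    exact: (measurableT_comp measurable_invr (measurableT_comp mid measurable_fst)).
  by rewrite -[X in measurable X]setTI; exact: (m measurableT [set k]).
have mA' : measurable A'.
  have m : measurable_fun setT (fun ze : measurableTypeR R * E' => T' delta' (ze.1 `^ (- a)) ze.2).
    apply: (measurableT_comp (mix_T'_measurable mix delta'0)
      (g := fun ze : measurableTypeR R * E' => (ze.1 `^ (- a), ze.2))).
    apply: measurable_fun_pair; last exact: measurable_snd.
    exact: (measurableT_comp (measurable_powR _) (measurableT_comp mid measurable_fst)).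
  by rewrite -[X in measurable X]setTI; exact: (m measurableT [set l]).
have indep (B : set (measurableTypeR R)) (C : set E) (C' : set E') :
    measurable B -> measurable C -> measurable C' ->
    (P (Zm @^-1` B `&` Um @^-1` C `&` Um' @^-1` C') =
     P (Zm @^-1` B) * P (Um @^-1` C) * P (Um' @^-1` C'))%E.
  by move=> mB; apply: (mix_indep mix).
have c1V0 : 0 < c1^-1 by rewrite invr_gt0.
have Zlaw z : 1 <= z -> P [set om | z < Zm om] = (z `^ (- c1^-1))%:E.
  by move=> z1; have := mix_Z_pareto mix z1.
transitivity (\int[distribution P Zm]_z (P (Um @^-1` xsection A z) * P (Um' @^-1` xsection A' z)))%E.
  exact: (probability_indep3 indep mA mA').
pose D1 : set (measurableTypeR R) := `]1, +oo[%classic.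
have m1 : measurable D1 by exact: measurable_itv.
have sec z : P (Um @^-1` xsection A z) = P [set om | T delta z^-1 (U om) = k].
  by congr (P _); apply/seteqP; split => om; rewrite /xsection /= inE.
have sec' z : P (Um' @^-1` xsection A' z) = P [set om | T' delta' (z `^ (- a)) (U' om) = l].
  by congr (P _); apply/seteqP; split => om; rewrite /xsection /= inE.
(* The point [Z = 1] is removed because both parameters equal 1 there, outside the range of the
   prescribed laws. *)
have PD1 : distribution P Zm D1 = 1%E.
  rewrite -[LHS](_ : P [set om | 1 < Zm om] = _); first by rewrite Zlaw// powR1.
  by congr (P _); apply/seteqP; split => om; rewrite /D1 /= in_itv/= andbT.
have N0 : distribution P Zm (~` D1) = 0%E.
  transitivity (1 - distribution P Zm D1)%E; last by rewrite PD1 subee.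
  exact: probability_setC.
have msec : measurable_fun [set: measurableTypeR R]
    (fun z => (P (Um @^-1` xsection A z) * P (Um' @^-1` xsection A' z))%E).
  apply: emeasurable_funM.
    exact: (measurable_fun_xsection (distribution P Um) mA).
  exact: (measurable_fun_xsection (distribution P Um') mA').
rewrite (ge0_negligible_integral (measurableC m1) measurableT msec _ N0); last first.
  by move=> z _; rewrite mule_ge0.
rewrite setTD setCK.
pose f z := neg_binomial_pmf delta z^-1 k * neg_binomial_pmf delta' (z `^ (- a)) l.
transitivity (\int[distribution P Zm]_(z in D1) (f z)%:E)%E.
  apply: eq_integral => z; rewrite inE /D1 /= in_itv/= andbT => /(inv_powRN_itv01 a0)[h1 h2].
  by rewrite sec sec' (mix_T_law mix)// (mix_T'_law mix).
apply: (integral_pareto c1V0 s0 Zlaw).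
  apply: measurable_funM; apply: measurable_neg_binomial_pmf; first exact: measurable_invr.
  exact: measurable_powR.
move=> z /(inv_powRN_itv01 a0)[/andP[_ /ltW h1] /andP[_ /ltW h2]].
by rewrite mulr_ge0 ?neg_binomial_pmf_ge0.
Qed.

End MixturePmf.

(** * Asymptotics *)

Section Asymptotics.
Context {R : realType}.
Local Notation mu := (@lebesgue_measure R).
Implicit Types (w sigma c x y a s : R).

Lemma measurable_powR_expR_inv (D : set R) sigma c :
  measurable_fun D (fun w : R => w `^ (- sigma) * expR (- (c / w))).
Proof.
apply: measurable_funTS; apply: measurable_funM; first exact: measurable_powR.
apply: (measurableT_comp (@measurable_expR R)).
apply: (measurableT_comp (@oppr_measurable R _)).
by apply: measurable_funM => //; exact: measurable_invr.
Qed.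

(** On []0, 1]] the integrand is bounded, being [u^sigma * exp (- c u)] at [u = 1/w]; beyond 1 it is
    at most [w^(- sigma)], integrable since [sigma > 1]. *)
Lemma integrable_powR_expR_inv sigma c : 1 < sigma -> 0 < c ->
  mu.-integrable `]0, +oo[ (EFin \o (fun w : R => w `^ (- sigma) * expR (- (c / w)))).
Proof.
move=> s1 c0; have sV0 : 0 < sigma - 1 by rewrite subr_gt0.
have sg0 : 0 <= sigma by rewrite ltW// (lt_trans ltr01).
apply/integrableP; split; first by apply/measurable_EFinP; exact: measurable_powR_expR_inv.
have pos w : 0 <= w `^ (- sigma) * expR (- (c / w)) by rewrite mulr_ge0 ?powR_ge0 ?expR_ge0.
under eq_integral do rewrite /= ger0_norm//.
have -> : `]0, +oo[%classic = `]0, 1]%classic `|` `]1, +oo[%classic :> set R.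
  apply/seteqP; split => w /=; rewrite !in_itv/= !andbT.
    by move=> w0; have [w1|w1] := leP w 1; [left; rewrite w0|right].
  by case=> [/andP[]//|]; exact: lt_trans.
have dis : [disjoint (`]0, 1]%classic : set (measurableTypeR R)) & (`]1, +oo[%classic : set (measurableTypeR R))].
  rewrite disj_set2E; apply/eqP/seteqP; split => // w [/=]; rewrite !in_itv/= andbT => /andP[_ h1] h2.
  by move: h2; rewrite ltNge h1.
rewrite ge0_integral_setU//; last 2 first.
- by apply/measurable_EFinP; exact: measurable_powR_expR_inv.
- by move=> w _; rewrite lee_fin pos.
have [C HC] := powR_expR_bounded sg0 c0.
apply: lte_add_pinfty.
  apply: (@le_lt_trans _ _ (\int[mu]_(w in `]0%R, 1%R]) (cst C%:E w))%E); last first.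
    by rewrite integral_cst//= lebesgue_measure_itv/= lte_fin ltr01 -EFinB -EFinM ltry.
  apply: ge0_le_integral.
  - exact: measurable_itv.
  - by move=> w _; rewrite lee_fin pos.
  - by apply/measurable_EFinP; exact: measurable_powR_expR_inv.
  - exact: measurable_cst.
  move=> w /=; rewrite in_itv/= => /andP[w0 w1]; rewrite lee_fin.
  have := HC w^-1; rewrite invr_gt0 => /(_ w0).
  by rewrite -(powR_inv1 (ltW w0)) -powRrM mulN1r powR_inv1 ?(ltW w0).
apply: (@le_lt_trans _ _ (((sigma - 1)^-1)%:E * \int[mu]_(w in `]1%R, +oo[)
   ((sigma - 1) * w `^ (- (sigma - 1) - 1))%:E)%E); last first.
  by rewrite integral_powR_tail// -EFinM ltry.
rewrite -ge0_integralZl_EFin//=; last 3 first.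
- by move=> w _; rewrite lee_fin mulr_ge0 ?powR_ge0// ltW.
- by apply/measurable_EFinP; exact: measurable_powR_tail.
- by rewrite invr_ge0 ltW.
apply: ge0_le_integral.
- exact: measurable_itv.
- by move=> w _; rewrite lee_fin pos.
- by apply/measurable_EFinP; exact: measurable_powR_expR_inv.
- by apply: emeasurable_funM => //; apply/measurable_EFinP; exact: measurable_powR_tail.
move=> w /=; rewrite in_itv/= andbT => w1; rewrite lee_fin.
rewrite mulrA mulVf ?gt_eqF// mul1r (_ : - (sigma - 1) - 1 = - sigma); last by ring.
rewrite ler_piMr ?powR_ge0// expR_le1 oppr_le0 divr_ge0 ?(ltW c0)//.
by rewrite ltW// (lt_trans ltr01).
Qed.

Lemma measurable_limit_integrand (D : set R) sigma x y a :
  measurable_fun D (fun w : R => w `^ (- sigma) * expR (- (x / w + y / w `^ a))).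
Proof.
apply: measurable_funTS; apply: measurable_funM; first exact: measurable_powR.
apply: (measurableT_comp (@measurable_expR R)).
apply: (measurableT_comp (@oppr_measurable R _)).
apply: measurable_funD; first by apply: measurable_funM => //; exact: measurable_invr.
apply: measurable_funM => //; apply: (measurableT_comp measurable_invr).
exact: measurable_powR.
Qed.

Lemma integrable_limit_integrand sigma x y a : 1 < sigma -> 0 < x -> 0 < y ->
  mu.-integrable `]0, +oo[
    (EFin \o (fun w : R => w `^ (- sigma) * expR (- (x / w + y / w `^ a)))).
Proof.
move=> s1 x0 y0; apply: le_integrable (integrable_powR_expR_inv s1 x0) => //.
  by apply/measurable_EFinP; exact: measurable_limit_integrand.
move=> w /=; rewrite in_itv/= andbT => w0; rewrite lee_fin.
rewrite !ger0_norm ?mulr_ge0 ?powR_ge0 ?expR_ge0// ler_wpM2l ?powR_ge0//.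
by rewrite ler_expR lerN2 lerDl divr_ge0 ?powR_ge0// ltW.
Qed.

Definition prelimit_integrand sigma a s (k l : nat) w : R :=
  w `^ (- sigma) * (1 - (s * w)^-1) ^+ k * (1 - (s * w) `^ (- a)) ^+ l.

Lemma measurable_prelimit_integrand (D : set R) sigma a s k l :
  measurable_fun D (prelimit_integrand sigma a s k l).
Proof.
have ms : measurable_fun setT (fun w : R => s * w) by exact: mulrl_measurable.
apply: measurable_funTS; apply: measurable_funM; first apply: measurable_funM.
- exact: measurable_powR.
- apply: measurable_funX; apply: measurable_funB => //.
  exact: (measurableT_comp measurable_invr).
- apply: measurable_funX; apply: measurable_funB => //.
  exact: (measurableT_comp (measurable_powR _)).
Qed.

Lemma scaled_inv_bounds a s w : 0 < a -> 0 < s -> s^-1 < w ->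
  0 < (s * w)^-1 < 1 /\ 0 < (s * w) `^ (- a) < 1.
Proof.
move=> a0 s0 sw.
by apply: inv_powRN_itv01 => //; rewrite -ltr_pdivrMl// mulr1.
Qed.

(** The factor with exponent [l] is bounded by 1; the other one alone tames [w^(- sigma)] near 0. A
    common lower bound [x] of the ratios [k / s] makes the majorant uniform. *)
Lemma prelimit_integrand_bounds sigma a s k l w x : 0 < a -> 0 < s -> s^-1 < w ->
  x <= k%:R / s ->
  0 <= prelimit_integrand sigma a s k l w <= w `^ (- sigma) * expR (- (x / w)).
Proof.
move=> a0 s0 sw xk; have [/andP[h1 h2] /andP[h3 h4]] := scaled_inv_bounds a0 s0 sw.
have w0 : 0 < w by apply: lt_trans sw; rewrite invr_gt0.
rewrite /prelimit_integrand !mulr_ge0 ?powR_ge0 ?exprn_ge0 ?subr_ge0 ?(ltW h2) ?(ltW h4)//=.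
rewrite -[leRHS]mulr1 ler_pM ?mulr_ge0 ?powR_ge0 ?exprn_ge0 ?subr_ge0 ?(ltW h2) ?(ltW h4)//.
  rewrite ler_wpM2l ?powR_ge0//; apply: le_trans (onem_expn_le _ (ltW h2)) _.
  rewrite ler_expR lerN2 invfM mulrA ler_wpM2r ?invr_ge0//; exact: ltW.
by rewrite exprn_ile1 ?subr_ge0 ?(ltW h4)// lerBlDr lerDl ltW.
Qed.

Lemma cvg_prelimit_integrand (s : nat -> R) (k l : nat -> nat) sigma a x y w :
  0 < a -> 0 < w -> s n @[n --> \oo] --> +oo ->
  (k n)%:R / s n @[n --> \oo] --> x -> (l n)%:R / (s n) `^ a @[n --> \oo] --> y ->
  prelimit_integrand sigma a (s n) (k n) (l n) w @[n --> \oo] -->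
    w `^ (- sigma) * expR (- (x / w + y / w `^ a)).
Proof.
move=> a0 w0 sy kx ly.
have spos : \forall n \near \oo, 0 < s n by exact: (cvgryPgt s).1 sy 0.
have swy : s n * w @[n --> \oo] --> +oo.
  apply/cvgryPge => A; near=> n; rewrite -ler_pdivrMr//.
  near: n; exact: (cvgryPge s).1 sy _.
rewrite opprD expRD mulrA; apply: cvgM; first apply: cvgM; first exact: cvg_cst.
- apply: cvg_onem_expn.
  + near=> n; rewrite invr_ge0 mulr_ge0 ?(ltW w0)// ltW//; near: n; exact: spos.
  + apply/gtr0_cvgV0; last exact: swy.
    by near=> n; rewrite mulr_gt0//; near: n; exact: spos.
  + apply: (cvg_near_eq _ (cvgM kx (cvg_cst w^-1))); near=> n.
    by rewrite invfM mulrA.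
- apply: cvg_onem_expn.
  + by near=> n; rewrite powR_ge0.
  + exact: cvgVy_powR.
  + apply: (cvg_near_eq _ (cvgM ly (cvg_cst (w `^ a)^-1))); near=> n.
    have s0 : 0 < s n by near: n; exact: spos.
    by rewrite powRN powRM ?(ltW s0) ?(ltW w0)// invfM mulrA.
Unshelve. all: by end_near. Qed.

Lemma cvg_integral_prelimit (s : nat -> R) (k l : nat -> nat) sigma a x y :
  1 < sigma -> 0 < a -> 0 < x -> s n @[n --> \oo] --> +oo ->
  (k n)%:R / s n @[n --> \oo] --> x -> (l n)%:R / (s n) `^ a @[n --> \oo] --> y ->
  (\int[mu]_(w in `]((s n)^-1)%R, +oo[) (prelimit_integrand sigma a (s n) (k n) (l n) w)%:E
    @[n --> \oo] -->
   \int[mu]_(w in `]0%R, +oo[) (w `^ (- sigma) * expR (- (x / w + y / w `^ a)))%:E)%E.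
Proof.
move=> s1 a0 x0 sy kx ly.
have x20 : 0 < x / 2 by rewrite divr_gt0.
(* Dominated convergence wants its bound for every index, so the sequence is shifted past the rank
   [N] from which the ratio exceeds [x / 2]. *)
have : \forall n \near \oo, 0 < s n /\ x / 2 <= (k n)%:R / s n.
  near=> n; split; first by near: n; exact: (cvgryPgt s).1 sy 0.
  near: n; apply: (cvgr_ge _ kx); lra.
move=> [N _ HN].
(* Extension by zero moves the varying domains to a fixed one; each [w > 0] eventually exceeds
   [1 / s n]. *)
pose f_ n : R -> \bar R := EFin \o
  ((prelimit_integrand sigma a (s n) (k n) (l n)) \_ `](s n)^-1, +oo[).
have fE n : 0 < s n -> (\int[mu]_(w in `]((s n)^-1)%R, +oo[)
    (prelimit_integrand sigma a (s n) (k n) (l n) w)%:E = \int[mu]_(w in `]0%R, +oo[) f_ n w)%E.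
  move=> sn0.
  have -> : `](s n)^-1, +oo[%classic = `]0, +oo[%classic `&` `](s n)^-1, +oo[%classic :> set R.
    apply/seteqP; split => z /=; rewrite !in_itv/= !andbT; last by case.
    by move=> h; split => //; apply: lt_trans h; rewrite invr_gt0.
  rewrite integral_mkcondr; apply: eq_integral => w _.
  by rewrite /f_ /= /patch; case: ifPn.
rewrite -(cvg_shiftn N) /=.
under eq_fun => n do rewrite fE ?(HN (n + N)%N (leq_addl _ _)).1//.
apply: (@dominated_cvg _ _ _ mu `]0%R, +oo[%classic _ _ _
  (EFin \o (fun w : R => w `^ (- sigma) * expR (- ((x / 2) / w))))).
- exact: measurable_itv.
- move=> n; apply/measurable_EFinP/measurable_funTS/measurable_restrict => //.
  exact: measurable_prelimit_integrand.
- move=> w /=; rewrite in_itv/= andbT => w0.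
  apply: cvg_EFin; first exact: nearW.
  have h := @cvg_prelimit_integrand s k l sigma a x y w a0 w0 sy kx ly.
  rewrite -(cvg_shiftn N) /= in h.
  apply: cvg_near_eq h; near=> n.
  rewrite /f_ /= patchE ifT// inE /= in_itv/= andbT.
  have sn0 := (HN (n + N)%N (leq_addl _ _)).1.
  rewrite -ltf_pV2 ?posrE ?invr_gt0// invrK.
  near: n; move: sy; rewrite -(cvg_shiftn N) => h'.
  exact: (cvgryPgt _).1 h' _.
- by [].
- exact: integrable_powR_expR_inv.
- move=> n w /=; rewrite in_itv/= andbT => w0.
  have [sn0 xk] := HN (n + N)%N (leq_addl _ _).
  rewrite lee_fin /patch; case: ifPn => [|_].
    rewrite inE /= in_itv/= andbT => sw.
    have /andP[h1 h2] := prelimit_integrand_bounds sigma (l (n + N)%N) a0 sn0 sw xk.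
    by rewrite ger0_norm.
  by rewrite normr0 mulr_ge0 ?powR_ge0 ?expR_ge0.
Unshelve. all: by end_near. Qed.

End Asymptotics.

(** * Asymptotics of a single mixture component *)

Section MixtureAsymptotics.
Context {R : realType}.
Local Notation mu := (@lebesgue_measure R).
Implicit Types (x y w t : R).

Lemma powRD_gt0 x p q : 0 < x -> x `^ (p + q) = x `^ p * x `^ q.
Proof. by move=> x0; rewrite powRD// (gt_eqF x0) implybT. Qed.

Lemma cvg_nat_of_ratio (k : nat -> nat) (s : nat -> R) x : 0 < x ->
  s n @[n --> \oo] --> +oo -> (k n)%:R / s n @[n --> \oo] --> x ->
  k n @[n --> \oo] --> \oo.
Proof.
move=> x0 sy kx; apply/cvgnyPge => A; near=> n.
have s0 : 0 < s n by near: n; exact: (cvgryPgt s).1 sy 0.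
have h1 : x / 2 <= (k n)%:R / s n by near: n; apply: (cvgr_ge _ kx); lra.
have h2 : A%:R / (x / 2) <= s n by near: n; exact: (cvgryPge s).1 sy _.
have x20 : 0 < x / 2 by rewrite divr_gt0.
rewrite -(ler_nat R); move: h1 h2; rewrite ler_pdivlMr// ler_pdivrMr// mulrC => h1 h2.
exact: le_trans h2 h1.
Unshelve. all: by end_near. Qed.

(** The case [e = 1] serves the index shifts caused by [1 + X1] and [1 + Y2]. Truncation and shift
    lose at most 1 each, hence the error [2 / t n]. *)
Lemma cvg_truncn_ratio (t : nat -> R) x (e : nat) : 0 < x -> (e <= 1)%N ->
  t n @[n --> \oo] --> +oo ->
  (Num.truncn (t n * x) - e)%:R / t n @[n --> \oo] --> x.
Proof.
move=> x0 e1 ty.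
have tV : 2 * (t n)^-1 @[n --> \oo] --> (2 * 0 : R).
  apply: cvgMr; apply/gtr0_cvgV0; last exact: ty.
  exact: (cvgryPgt t).1 ty 0.
have lo : x - 2 * (t n)^-1 @[n --> \oo] --> x.
  by rewrite -[X in _ --> X]subr0 -[X in _ - X](mulr0 2); apply: cvgB => //; exact: cvg_cst.
have hi : (fun _ : nat => x) @ \oo --> x by exact: cvg_cst.
apply: squeeze_cvgr lo hi; near=> n.
have t0 : 0 < t n by near: n; exact: (cvgryPgt t).1 ty 0.
have tx0 : 0 <= t n * x by rewrite mulr_ge0// ltW.
have /andP[h1 h2] := truncn_itv tx0.
set m := Num.truncn (t n * x) in h1 h2 *.
have h3 : m%:R <= (m - e)%:R + 1 :> R by rewrite natr1 ler_nat; lia.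
have h4 : (m - e)%:R <= m%:R :> R by rewrite ler_nat leq_subr.
have h5 : t n * x < m%:R + 1 by rewrite natr1.
rewrite ler_pdivlMr// ler_pdivrMr// mulrBl -mulrA mulVf ?gt_eqF// mulr1.
by rewrite !(mulrC x); apply/andP; split; lra.
Unshelve. all: by end_near. Qed.

Context (c1 a : R) {d : measure_display} {Om : measurableType d} (P : probability Om R)
  {d1 : measure_display} {E : measurableType d1} {d2 : measure_display} {E' : measurableType d2}
  (Z : Om -> R) (U : Om -> E) (U' : Om -> E') (T : R -> R -> E -> nat) (T' : R -> R -> E' -> nat).
Hypotheses (c10 : 0 < c1) (a0 : 0 < a) (mix : mixing_variables c1 P Z U U' T T').
Variables (delta delta' : R).
Hypotheses (delta0 : 0 < delta) (delta'0 : 0 < delta').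

Definition mixture_pmf (k l : nat) : R := fine (P
  [set om | T delta (Z om)^-1 (U om) = k /\ T' delta' (Z om `^ (- a)) (U' om) = l]).

(** The Pareto density contributes [c1^-1 + 1], the factors [q^delta] at [q = (s w)^-1] and
    [q^delta'] at [q = (s w)^-a] the rest. *)
Let sigma := c1^-1 + 1 + delta + a * delta'.

Lemma mixture_pmf_prelimit s k l : 0 < s ->
  mixture_pmf k l =
  Gamma (k%:R + delta) / (Gamma delta * Gamma (k%:R + 1)) *
  (Gamma (l%:R + delta') / (Gamma delta' * Gamma (l%:R + 1))) * c1^-1 *
  s `^ (- (c1^-1 + delta + a * delta')) *
  fine (\int[mu]_(w in `](s^-1)%R, +oo[) (prelimit_integrand sigma a s k l w)%:E)%E.
Proof.
move=> s0; rewrite /mixture_pmf (mixture_pmfE c10 a0 mix delta0 delta'0 k l s0).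
set K := (X in _ = X * _).
have K0 : 0 <= K.
  have g (n : nat) e : 0 < e -> 0 <= Gamma (n%:R + e).
    by move=> e0; rewrite ltW// Gamma_gt0// ltr_wpDl.
  have q (n : nat) e : 0 < e -> 0 <= Gamma (n%:R + e) / (Gamma e * Gamma (n%:R + 1)).
    move=> e0; apply: divr_ge0; first exact: g.
    by apply: mulr_ge0; [exact: ltW (Gamma_gt0 e0)|exact: g].
  rewrite /K; apply: mulr_ge0; last exact: powR_ge0.
  apply: mulr_ge0; last by rewrite invr_ge0 ltW.
  by apply: mulr_ge0; exact: q.
transitivity (fine (\int[mu]_(w in `](s^-1)%R, +oo[)
    (K%:E * (prelimit_integrand sigma a s k l w)%:E))%E).
  congr fine; apply: eq_integral => w; rewrite inE /= in_itv/= andbT => sw.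
  have w0 : 0 < w by apply: lt_trans sw; rewrite invr_gt0.
  have sw0 : 0 < s * w by rewrite mulr_gt0.
  rewrite -EFinM; congr EFin; rewrite /neg_binomial_pmf /prelimit_integrand /K.
  rewrite -(powR_inv1 (ltW sw0)) -!powRrM mulN1r powR_inv1 ?(ltW sw0)//.
  rewrite !(powRM _ (ltW s0) (ltW w0)).
  have -> : - sigma = (- c1^-1 - 1) + (- delta) + (- a * delta') by rewrite /sigma; ring.
  have -> : - (c1^-1 + delta + a * delta') = (- c1^-1) + (- delta) + (- a * delta') by ring.
  rewrite !(powRD_gt0 _ _ s0) !(powRD_gt0 _ _ w0).
  set W1 := (1 - _) ^+ k; set W2 := (1 - _) ^+ l; ring.
have pos w : `]s^-1, +oo[%classic w -> 0 <= prelimit_integrand sigma a s k l w.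
  rewrite /= in_itv/= andbT => sw.
  have xk : 0 <= k%:R / s by rewrite divr_ge0// ltW.
  by have /andP[] := prelimit_integrand_bounds sigma l a0 s0 sw xk.
rewrite ge0_integralZl_EFin//; last first.
  by apply/measurable_EFinP; exact: measurable_prelimit_integrand.
(* For an infinite integral [fine] returns 0 on both sides, so the nonnegative constant comes out
   without integrability. *)
case: (\int[mu]_(w in _) _)%E => [r| |] /=; first by [].
- by have [->|Kn0] := eqVneq K 0; rewrite ?mul0e ?mul0r// gt0_muley ?mulr0// lte_fin lt_neqAle eq_sym Kn0.
- by have [->|Kn0] := eqVneq K 0; rewrite ?mul0e ?mul0r// gt0_muleNy ?mulr0// lte_fin lt_neqAle eq_sym Kn0.
Qed.

Lemma cvg_mixture_pmf (s : nat -> R) (k l : nat -> nat) x y :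
  0 < x -> 0 < y -> s n @[n --> \oo] --> +oo ->
  (k n)%:R / s n @[n --> \oo] --> x -> (l n)%:R / (s n) `^ a @[n --> \oo] --> y ->
  mixture_pmf (k n) (l n) * (s n) `^ (c1^-1 + 1 + a) @[n --> \oo] -->
  x `^ (delta - 1) * y `^ (delta' - 1) / (c1 * Gamma delta * Gamma delta') *
  Rintegral mu `]0, +oo[ (fun w => w `^ (- sigma) * expR (- (x / w + y / w `^ a))).
Proof.
move=> x0 y0 sy kx ly.
have s1 : 1 < sigma.
  rewrite /sigma -!addrA addrCA ltrDl !addr_gt0 ?invr_gt0//; exact: mulr_gt0.
have say : (s n) `^ a @[n --> \oo] --> +oo by exact: cvgy_powR.
have koo := cvg_nat_of_ratio x0 sy kx.
have loo := cvg_nat_of_ratio y0 say ly.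
have intL := integrable_limit_integrand a s1 x0 y0.
have IE := fineK (integrable_fin_num measurable_itv_gt0 intL).
have hI := cvg_integral_prelimit s1 a0 x0 sy kx ly.
rewrite -[X in _ --> X]IE in hI.
have {}hI : fine (\int[mu]_(w in `]((s n)^-1)%R, +oo[)
    (prelimit_integrand sigma a (s n) (k n) (l n) w)%:E)%E @[n --> \oo] -->
    Rintegral mu `]0, +oo[ (fun w => w `^ (- sigma) * expR (- (x / w + y / w `^ a))).
  exact: fine_cvg.
have hGk := cvg_comp _ _ koo (cvg_Gamma_ratio delta0).
have hGl := cvg_comp _ _ loo (cvg_Gamma_ratio delta'0).
have hk : ((k n)%:R / s n) `^ (delta - 1) @[n --> \oo] --> x `^ (delta - 1).
  exact: cvg_powR.
have hl : ((l n)%:R / s n `^ a) `^ (delta' - 1) @[n --> \oo] --> y `^ (delta' - 1).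
  exact: cvg_powR.
pose C := c1^-1 / (Gamma delta * Gamma delta').
have H := cvgM (cvgM (cvgM (cvgM hGk hk) (cvgM hGl hl)) (cvg_cst C)) hI.
set L := (X in _ --> X).
have LE : 1 * x `^ (delta - 1) * (1 * y `^ (delta' - 1)) * C *
    Rintegral mu `]0, +oo[ (fun w => w `^ (- sigma) * expR (- (x / w + y / w `^ a))) = L.
  by rewrite /L /C !mul1r -invfM mulrA.
rewrite -LE; apply: (@cvg_near_eq R nat \oo _ (fun n =>
  (Gamma ((k n)%:R + delta) / Gamma ((k n)%:R + 1) * (k n)%:R `^ (1 - delta)) *
  ((k n)%:R / s n) `^ (delta - 1) *
  ((Gamma ((l n)%:R + delta') / Gamma ((l n)%:R + 1) * (l n)%:R `^ (1 - delta')) *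
  ((l n)%:R / s n `^ a) `^ (delta' - 1)) * C *
  fine (\int[mu]_(w in `]((s n)^-1)%R, +oo[)
    (prelimit_integrand sigma a (s n) (k n) (l n) w)%:E)%E)); last exact: H.
near=> n.
have sn0 : 0 < s n by near: n; exact: (cvgryPgt s).1 sy 0.
have kn0 : 0 < (k n)%:R :> R by rewrite ltr0n; near: n; exact: (cvgnyPge k).1 koo 1%N.
have ln0 : 0 < (l n)%:R :> R by rewrite ltr0n; near: n; exact: (cvgnyPge l).1 loo 1%N.
rewrite (mixture_pmf_prelimit _ _ sn0); set I := fine _.
(* The normalisations [k^(1 - delta)] and [(k / s)^(delta - 1)] combine into a power of [s] alone;
   likewise for [l] and [s^a]. *)
have cancel (p q r : R) : 0 < p -> 0 < q -> p `^ (1 - r) * (p / q) `^ (r - 1) = q `^ (1 - r).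
  move=> p0 q0; have p0' := ltW p0; have q0' := ltW q0.
  rewrite powRM ?invr_ge0// mulrA -powRD_gt0//.
  have -> : 1 - r + (r - 1) = 0 by ring.
  rewrite powRr0 mul1r -(powR_inv1 q0') -powRrM; congr (_ `^ _); ring.
have E1 := cancel _ _ delta kn0 sn0.
have E2 := cancel _ _ delta' ln0 (powR_gt0 a sn0).
have E3 : s n `^ (- (c1^-1 + delta + a * delta')) * s n `^ (c1^-1 + 1 + a) =
    s n `^ (1 - delta) * (s n `^ a) `^ (1 - delta').
  by rewrite -powRrM -!powRD_gt0//; congr (_ `^ _); ring.
transitivity (Gamma ((k n)%:R + delta) / Gamma ((k n)%:R + 1) *
  (Gamma ((l n)%:R + delta') / Gamma ((l n)%:R + 1)) * C * I *
  (s n `^ (1 - delta) * (s n `^ a) `^ (1 - delta'))).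
  rewrite -E1 -E2; ring.
rewrite -E3 /C !invfM; ring.
Unshelve. all: by end_near. Qed.

End MixtureAsymptotics.

(** * The joint mass function and its scaling limit *)

Section JointPmf.
Context {R : realType}.
Local Notation mu := (@lebesgue_measure R).
Context (alpha gamma lambda mu_ c1 a : R) (p : nat -> nat -> R)
  {d : measure_display} {Om : measurableType d} (P : probability Om R)
  {d1 : measure_display} {E : measurableType d1} {d2 : measure_display} {E' : measurableType d2}
  (B : Om -> bool) (Z : Om -> R) (U : Om -> E) (U' : Om -> E')
  (T : R -> R -> E -> nat) (T' : R -> R -> E' -> nat).
Hypotheses (alpha0 : 0 < alpha) (gamma0 : 0 < gamma) (lambda0 : 0 < lambda) (mu0 : 0 < mu_).
Hypotheses (c10 : 0 < c1) (a0 : 0 < a).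
Hypothesis repr : mixture_representation alpha gamma lambda mu_ c1 a p P B Z U U' T T'.

(** Splitting on [B] leaves [X1 = i - 1] or [Y2 = j - 1]. Positivity of [i] and [j] makes these
    truncated subtractions faithful, and along the scaling it holds eventually. *)
Lemma joint_pmfE (i j : nat) : (0 < i)%N -> (0 < j)%N ->
  p i j = gamma / (alpha + gamma) * mixture_pmf a P Z U U' T T' (lambda + 1) mu_ (i - 1) j +
          alpha / (alpha + gamma) * mixture_pmf a P Z U U' T T' lambda (mu_ + 1) i (j - 1).
Proof.
move=> i0 j0; have [mix [mB PB indB1] [_ _ indB2] pE] := repr.
have l10 : 0 < lambda + 1 by rewrite addr_gt0.
have m10 : 0 < mu_ + 1 by rewrite addr_gt0.
have ag0 : alpha + gamma != 0 by rewrite gt_eqF// addr_gt0.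
have mBb b : measurable [set om | B om = b].
  by rewrite -[X in measurable X]setTI; exact: (mB measurableT [set b]).
have PB' : P [set om | B om = false] = (alpha / (alpha + gamma))%:E.
  have -> : [set om | B om = false] = ~` [set om | B om = true].
    by apply/seteqP; split => om /=; case: (B om).
  rewrite probability_setC// PB -EFinB; congr EFin; field.
  exact: ag0.
pose X1 := [set om | T (lambda + 1) (Z om)^-1 (U om) = (i - 1)%N /\ T' mu_ (Z om `^ (- a)) (U' om) = j].
pose X2 := [set om | T lambda (Z om)^-1 (U om) = i /\ T' (mu_ + 1) (Z om `^ (- a)) (U' om) = (j - 1)%N].
have mX1 : measurable X1 by exact: (measurable_mixing_event a mix l10 mu0).
have mX2 : measurable X2 by exact: (measurable_mixing_event a mix lambda0 m10).
apply: EFin_inj; rewrite pE.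
transitivity (P (([set om | B om = true] `&` X1) `|` ([set om | B om = false] `&` X2))).
  congr (P _); apply/seteqP; split => om /=; rewrite /X1 /X2 /=.
    case: (B om); rewrite /= ?mul1n ?mul0n ?addn0 ?add0n => -[hi hj].
      by left; split => //; split => //; rewrite -hi add1n subn1.
    by right; split => //; split => //; rewrite -hj add1n subn1.
  case=> -[-> [-> ->]]; rewrite /= ?mul1n ?mul0n ?addn0 ?add0n; split => //; exact: subnKC.
rewrite measureU//; [|exact: measurableI|exact: measurableI|]; last first.
  by apply/seteqP; split => // om [[/= -> _] [h _]].
rewrite /mixture_pmf EFinD; congr (_ + _)%E.
- transitivity (P [set om | B om = true] * P X1)%E; first exact: indB1.
  by rewrite PB [RHS]EFinM fineK// fin_num_measure.
- transitivity (P [set om | B om = false] * P X2)%E; first exact: indB2.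
  by rewrite PB' [RHS]EFinM fineK// fin_num_measure.
Qed.

Lemma cvg_joint_pmf (c2 : R) (u : nat -> R) (x y : R) :
  0 < x -> 0 < y -> a = c2 / c1 -> u n @[n --> \oo] --> +oo ->
  p (Num.truncn (u n `^ c1 * x)) (Num.truncn (u n `^ c2 * y)) / u n `^ (- (1 + c1 + c2))
    @[n --> \oo] -->
  gamma / (alpha + gamma)
    * (x `^ lambda * y `^ (mu_ - 1) / (c1 * Gamma (lambda + 1) * Gamma mu_))
    * Rintegral mu `]0, +oo[ (fun z : R => z `^ (- (2 + c1^-1 + lambda + a * mu_))
                                        * expR (- (x / z + y / z `^ a)))
  + alpha / (alpha + gamma)
    * (x `^ (lambda - 1) * y `^ mu_ / (c1 * Gamma lambda * Gamma (mu_ + 1)))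
    * Rintegral mu `]0, +oo[ (fun z : R => z `^ (- (1 + a + c1^-1 + lambda + a * mu_))
                                        * expR (- (x / z + y / z `^ a))).
Proof.
move=> x0 y0 aE uy.
have [mix _ _ _] := repr.
have l10 : 0 < lambda + 1 by rewrite addr_gt0.
have m10 : 0 < mu_ + 1 by rewrite addr_gt0.
have c1n : c1 != 0 by rewrite gt_eqF.
have c2E : c2 = c1 * a by rewrite aE; field.
(* With this scale [s^a = u^c2] and [s^(1/c1 + 1 + a) = u^(1 + c1 + c2)]. *)
pose s n := u n `^ c1.
have sy : s n @[n --> \oo] --> +oo by exact: cvgy_powR.
have say : s n `^ a @[n --> \oo] --> +oo by exact: cvgy_powR.
have saE n : s n `^ a = u n `^ c2 by rewrite -powRrM c2E.
pose i n := Num.truncn (s n * x); pose j n := Num.truncn (s n `^ a * y).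
have i0 := cvg_truncn_ratio x0 (leq0n 1) sy.
have i1 := cvg_truncn_ratio x0 (leqnn 1) sy.
have j0 := cvg_truncn_ratio y0 (leq0n 1) say.
have j1 := cvg_truncn_ratio y0 (leqnn 1) say.
have {}i0 : (i n)%:R / s n @[n --> \oo] --> x by apply: cvg_near_eq i0; near=> n; rewrite subn0.
have {}j0 : (j n)%:R / s n `^ a @[n --> \oo] --> y by apply: cvg_near_eq j0; near=> n; rewrite subn0.
have ioo := cvg_nat_of_ratio x0 sy i0.
have joo := cvg_nat_of_ratio y0 say j0.
have H1 := cvg_mixture_pmf c10 a0 mix l10 mu0 x0 y0 sy i1 j0.
have H2 := cvg_mixture_pmf c10 a0 mix lambda0 m10 x0 y0 sy i0 j1.
rewrite addrK in H1; rewrite addrK in H2.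
have e1 : c1^-1 + 1 + (lambda + 1) + a * mu_ = 2 + c1^-1 + lambda + a * mu_ by ring.
have e2 : c1^-1 + 1 + lambda + a * (mu_ + 1) = 1 + a + c1^-1 + lambda + a * mu_ by ring.
rewrite e1 in H1; rewrite e2 in H2.
rewrite -(mulrA (gamma / (alpha + gamma))) -(mulrA (alpha / (alpha + gamma))).
have H := cvgD (cvgM (cvg_cst (gamma / (alpha + gamma))) H1) (cvgM (cvg_cst (alpha / (alpha + gamma))) H2).
apply: (@cvg_near_eq R nat \oo _ (fun n =>
  gamma / (alpha + gamma) * (mixture_pmf a P Z U U' T T' (lambda + 1) mu_ (i n - 1) (j n) * s n `^ (c1^-1 + 1 + a)) +
  alpha / (alpha + gamma) * (mixture_pmf a P Z U U' T T' lambda (mu_ + 1) (i n) (j n - 1) * s n `^ (c1^-1 + 1 + a)))); last exact: H.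
near=> n.
have un0 : 0 < u n by near: n; exact: (cvgryPgt u).1 uy 0.
have in0 : (0 < i n)%N by near: n; exact: (cvgnyPge i).1 ioo 1%N.
have jn0 : (0 < j n)%N by near: n; exact: (cvgnyPge j).1 joo 1%N.
rewrite -saE -/(s n) -/(i n) -/(j n) joint_pmfE// powRN invrK.
have -> : u n `^ (1 + c1 + c2) = s n `^ (c1^-1 + 1 + a).
  by rewrite -powRrM; congr (_ `^ _); rewrite c2E; field.
ring.
Unshelve. all: by end_near. Qed.

End JointPmf.

(** * Regular variation and embeddability *)

Lemma RV_powR (R : realType) (rho : R) : RV rho (fun t : R => t `^ rho).
Proof.
split.
- by move=> t t0; rewrite powR_gt0.
- by apply: measurable_funTS; exact: measurable_powR.
- move=> x x0; apply: (cvg_near_eq _ (cvg_cst (x `^ rho))); near=> t.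
  have t0 : 0 < t by near: t; exact: nbhs_pinfty_gt.
  by rewrite powRM ?(ltW t0) ?(ltW x0)// mulrAC mulfV ?mul1r// gt_eqF// powR_gt0.
Unshelve. all: by end_near. Qed.

Theorem proposition4p1 (R : realType) (alpha beta gamma lambda mu : R)
  (alpha_gt0 : 0 < alpha) (beta_gt0 : 0 < beta) (gamma_gt0 : 0 < gamma)
  (lambda_gt0 : 0 < lambda) (mu_gt0 : 0 < mu)
  (abg1 : alpha + beta + gamma = 1)
  (alpha_lt1 : alpha < 1) (beta_lt1 : beta < 1) (gamma_lt1 : gamma < 1)
  (n0 : nat) (g0 : digraph)
  (d : measure_display) (Omega : measurableType d) (P : probability Omega R)
  (G : nat -> Omega -> digraph)
  (model : preferential_attachment alpha beta gamma lambda mu n0 g0 P G)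
  (p : nat -> nat -> R) (p_lim : asymptotic_joint_pmf P G p)
  (c1 c2 a : R)
  (c1E : c1 = (alpha + beta) / (1 + lambda * (alpha + gamma)))
  (c2E : c2 = (beta + gamma) / (1 + mu * (alpha + gamma)))
  (aE : a = c2 / c1)
  (d' : measure_display) (Omega' : measurableType d') (P' : probability Omega' R)
  (d1 : measure_display) (E : measurableType d1)
  (d2 : measure_display) (E' : measurableType d2)
  (B : Omega' -> bool) (Z : Omega' -> R) (U : Omega' -> E) (U' : Omega' -> E')
  (T : R -> R -> E -> nat) (T' : R -> R -> E' -> nat)
  (p_repr : mixture_representation alpha gamma lambda mu c1 a p P' B Z U U' T T')
  (c1_neq_c2 : c1 <> c2) :
  let b1 := fun t : R => t `^ c1 in
  let b2 := fun t : R => t `^ c2 in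
  [/\ embeddable b1 b2 p,
      nonstandard_regularly_varying b1 b2 p &
      forall x y : R, 0 < x -> 0 < y ->
        p (Num.truncn (n%:R `^ c1 * x)) (Num.truncn (n%:R `^ c2 * y))
          / n%:R `^ (- (1 + c1 + c2)) @[n --> \oo] -->
        gamma / (alpha + gamma)
          * (x `^ lambda * y `^ (mu - 1) / (c1 * Gamma (lambda + 1) * Gamma mu))
          * Rintegral (@lebesgue_measure R) `]0, +oo[
              (fun z : R => z `^ (- (2 + c1^-1 + lambda + a * mu))
                            * expR (- (x / z + y / z `^ a)))
        + alpha / (alpha + gamma)
          * (x `^ (lambda - 1) * y `^ mu / (c1 * Gamma lambda * Gamma (mu + 1)))
          * Rintegral (@lebesgue_measure R) `]0, +oo[
              (fun z : R => z `^ (- (1 + a + c1^-1 + lambda + a * mu))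
                            * expR (- (x / z + y / z `^ a)))].
Proof.
move=> b1 b2.
have ag0 : 0 < alpha + gamma by rewrite addr_gt0.
have c10 : 0 < c1 by rewrite c1E divr_gt0 ?addr_gt0// mulr_gt0.
have c20 : 0 < c2 by rewrite c2E divr_gt0 ?addr_gt0// mulr_gt0.
have a0 : 0 < a by rewrite aE divr_gt0.
have seqlim (u : nat -> R) (x y : R) (x0 : 0 < x) (y0 : 0 < y) :=
  @cvg_joint_pmf R alpha gamma lambda mu c1 a p _ _ P' _ _ _ _ B Z U U' T T'
    alpha_gt0 gamma_gt0 lambda_gt0 mu_gt0 c10 a0 p_repr c2 u x y x0 y0 aE.
(* Both summands of the limit have this shape, and regular variation requires the limit to be
   positive. *)
have lpos (x y sg A0 s1 s2 G1 G2 : R) : 0 < x -> 0 < y -> 1 < sg -> 0 < A0 ->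
    0 < G1 -> 0 < G2 -> 0 < A0 * (x `^ s1 * y `^ s2 / (c1 * G1 * G2)) *
      Rintegral (@lebesgue_measure R) `]0, +oo[
        (fun z : R => z `^ (- sg) * expR (- (x / z + y / z `^ a))).
  move=> x0 y0 sg1 A00 G10 G20; apply: mulr_gt0.
    by rewrite mulr_gt0// divr_gt0// ?mulr_gt0// powR_gt0.
  apply: Rintegral_gt0; first exact: integrable_limit_integrand.
  by move=> z z0; rewrite mulr_gt0 ?powR_gt0 ?expR_gt0.
have limpos (x y : R) : 0 < x -> 0 < y ->
    0 < gamma / (alpha + gamma)
          * (x `^ lambda * y `^ (mu - 1) / (c1 * Gamma (lambda + 1) * Gamma mu))
          * Rintegral (@lebesgue_measure R) `]0, +oo[
              (fun z : R => z `^ (- (2 + c1^-1 + lambda + a * mu))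
                            * expR (- (x / z + y / z `^ a)))
        + alpha / (alpha + gamma)
          * (x `^ (lambda - 1) * y `^ mu / (c1 * Gamma lambda * Gamma (mu + 1)))
          * Rintegral (@lebesgue_measure R) `]0, +oo[
              (fun z : R => z `^ (- (1 + a + c1^-1 + lambda + a * mu))
                            * expR (- (x / z + y / z `^ a))).
  move=> x0 y0.
  have c1V : 0 < c1^-1 by rewrite invr_gt0.
  have am : 0 < a * mu by rewrite mulr_gt0.
  by apply: addr_gt0; apply: lpos; rewrite ?divr_gt0 ?Gamma_gt0 ?addr_gt0//; lra.
split.
- exists (- (1 + c1 + c2)), (fun t => t `^ (- (1 + c1 + c2))); split; first exact: RV_powR.
  move=> x y x0 y0; eexists; first exact: (limpos x y x0 y0).
  (* Convergence as real [t] tends to infinity is tested along all sequences [u] tending to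
     infinity. *)
  by apply/cvg_pinftyP => u uy; exact: seqlim.
- exists (- (1 + c1 + c2)), (fun t => t `^ (- (1 + c1 + c2))); split; first exact: RV_powR.
  move=> x y x0 y0; eexists; first exact: (limpos x y x0 y0).
  by apply: seqlim => //; exact: cvgr_idn.
- by move=> x y x0 y0; apply: seqlim => //; exact: cvgr_idn.
Qed.
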